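(* Let $n\ge 2$ and let $S$ be a $\mathcal{U}_n$-invariant, finite-dimensional subspace of $C(\mathbb{S}^{n-1})$ which is accessible. Then for every $\xi\in\mathbb{S}^{n-1}$ (in particular for $\xi=e_1$) $$\boldsymbol{\lambda}(S) = \big\|\pi_{S} \colon C(\mathbb{S}^{n-1}) \to S\big\|=\int_{\mathbb{S}^{n-1} }\big|\mathbf{k}_S(\xi,z) \big|\, d\sigma_n (z).$$
   Context: $\mathbb{S}^{n-1}=\{z\in\mathbb{C}^n:\|z\|_2=1\}$ is the complex Euclidean sphere, $\sigma_n$ its normalized rotation-invariant measure, $C(\mathbb{S}^{n-1})$ the space of continuous complex-valued functions with the supremum norm, $\mathcal{U}_n$ the group of unitary operators on $\mathbb{C}^n$, and $e_1$ the first standard unit vector. A subspace $S\subset C(\mathbb{S}^{n-1})$ is $\mathcal{U}_n$-invariant if $f\circ U\in S$ for all $f\in S$, $U\in\mathcal{U}_n$. For finite-dimensional $S$, $\pi_S$ is the orthogonal projection from $L_2(\sigma_n)$ onto $S$ (also its restriction to $C(\mathbb{S}^{n-1})$), and $\mathbf{k}_S:\mathbb{S}^{n-1}\times\mathbb{S}^{n-1}\to\mathbb{C}$ is its reproducing kernel, i.e. the unique continuous function with $(\pi_Sf)(x)=\int f(y)\overline{\mathbf{k}_S(x,y)}\,d\sigma_n(y)$ for all $f\in L_2(\sigma_n)$ and $x\in\mathbb{S}^{n-1}$. A finite-dimensional subspace $S$ of $C(\mathbb{S}^{n-1})$ is accessible if it is $\mathcal{U}_n$-invariant and $\pi_S|_{C(\mathbb{S}^{n-1})}$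 is the unique (bounded linear) projection $\mathbf{Q}$ from $C(\mathbb{S}^{n-1})$ onto $S$ such that $\mathbf{Q}(f\circ U)=\mathbf{Q}(f)\circ U$ for all $f\in C(\mathbb{S}^{n-1})$ and $U\in\mathcal{U}_n$. For a Banach space $Y$ and a closed complemented subspace $X\subset Y$, $\boldsymbol{\lambda}(X,Y)$ is the infimum of the norms of all bounded linear projections from $Y$ onto $X$. The (absolute) projection constant of a Banach space $X$ is $\boldsymbol{\lambda}(X)=\sup\boldsymbol{\lambda}(I(X),Y)$, the supremum over all Banach spaces $Y$ and isometric embeddings $I:X\to Y$. If $X$ is a finite-dimensional subspace of $C(K)$, then $\boldsymbol{\lambda}(X)=\boldsymbol{\lambda}(X,C(K))$. *)

(* Defs.v *)
From HB Require Import structures.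
From mathcomp Require Import all_boot all_order all_algebra.
From mathcomp Require Import complex.
From mathcomp Require Import all_classical all_reals all_analysis.
Import numFieldNormedType.Exports.

Set Implicit Arguments.
Unset Strict Implicit.
Unset Printing Implicit Defensive.

Import Order.TTheory GRing.Theory Num.Theory ComplexField.Normc.
Local Open Scope classical_set_scope.
Local Open Scope ring_scope.
Local Open Scope complex_scope.

(* The modulus of R[i], viewed as a normed space over itself, takes its values
   in R[i]; [normc] is the same modulus with values in R. *)
HB.instance Definition _ (R : realType) := NormedModule.copy R[i] R[i]^o.

Section ComplexBasics.
Context (R : realType).
Implicit Types (x : R[i]).

Lemma normr_normc x : `|x| = (normc x)%:C.
Proof. by []. Qed.

Lemma normc_ge0 x : 0 <= normc x.
Proof. by rewrite -ler0c -normr_normc normr_ge0. Qed.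

Lemma continuous_normc : continuous (@normc R : R[i] -> R).
Proof.
move=> x A /nbhs_normP [e /= e0 eA].
apply/nbhs_normP; exists e%:C => [|y /= h]; first by rewrite /= ltcR.
apply: eA => /=; rewrite -ltcR; apply: le_lt_trans h.
have -> : `|normc x - normc y|%:C = `| `|x| - `|y| |.
  by rewrite !normr_normc -rmorphB /= expr0n /= addr0 sqrtr_sqr.
exact: ler_dist_dist.
Qed.

Lemma continuous_real_complex : continuous (real_complex R : R -> R[i]).
Proof.
move=> x A /nbhs_normP [e /= e0 eA].
have er : (complex.Re e)%:C = e by rewrite RRe_real // gtr0_real.
apply/nbhs_normP; exists (complex.Re e) => [|y /= h].
  by rewrite /= -ltcR er.
apply: eA => /=; rewrite -rmorphB normr_normc /= expr0n /= addr0 sqrtr_sqr.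
by rewrite -er ltcR.
Qed.

Lemma continuous_sum (K : numFieldType) (T : topologicalType)
    (V : normedModType K) (I : Type) (r : seq I) (f : I -> T -> V) :
  (forall i, continuous (f i)) -> continuous (fun t => \sum_(i <- r) f i t).
Proof.
move=> fc; elim: r => [|i r IH].
  under eq_fun do rewrite big_nil.
  exact: cst_continuous.
under eq_fun do rewrite big_cons.
by move=> t; apply: continuousD; [exact: fc | exact: IH].
Qed.

End ComplexBasics.

Section CSphere.
Context (R : realType).

Definition l2norm n (z : 'cV[R[i]]_n) : R :=
  Num.sqrt (\sum_(i < n) normc (z i 0) ^+ 2).

Lemma continuous_l2norm n : continuous (@l2norm n).
Proof.
move=> z; apply: (@continuous_comp _ _ _ (fun z : 'cV[R[i]]_n =>
  \sum_(i < n) normc (z i 0) ^+ 2) Num.sqrt); last exact: sqrt_continuous.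
move: z; apply: continuous_sum => i z.
apply: (@continuous_comp _ _ _ (fun z : 'cV[R[i]]_n => normc (z i 0))
  (fun x : R => x ^+ 2)); last exact: exprn_continuous.
apply: (@continuous_comp _ _ _ (fun z : 'cV[R[i]]_n => z i 0)
  (@normc R)); first exact: coord_continuous.
exact: continuous_normc.
Qed.

(* S^m, the unit sphere of C^(m+1), with the topology induced by C^(m+1) *)
Definition sphere_set m : set 'cV[R[i]]_m.+1 := [set z | l2norm z = 1].

Definition csphere m : Type := set_type (@sphere_set m).

HB.instance Definition _ m :=
  Topological.copy (csphere m) (set_type (@sphere_set m)).

Definition vec m (z : csphere m) : 'cV[R[i]]_m.+1 := set_val z.

Definition to_csphere m (z : 'cV[R[i]]_m.+1) (hz : l2norm z = 1) : csphere m :=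
  exist (fun z => z \in @sphere_set m) z (mem_set hz).

Lemma csphereP m (z : csphere m) : l2norm (vec z) = 1.
Proof. by case: z => z zS; exact: (set_mem zS). Qed.

Lemma l2norm_e1 m : l2norm (delta_mx 0 0 : 'cV[R[i]]_m.+1) = 1.
Proof.
rewrite /l2norm (bigD1 0) //= big1 => [|i /negbTE i0].
  by rewrite mxE !eqxx [normc _]normc1 expr1n addr0 sqrtr1.
by rewrite mxE i0 [normc _]normc0 expr0n.
Qed.

Definition e1 m : csphere m := to_csphere (@l2norm_e1 m).

HB.instance Definition _ m := isPointed.Build (csphere m) (e1 m).

Lemma sphere_set_compact m : compact (@sphere_set m).
Proof.
set k := m.+1.
pose co j (v : 'rV[R]_(k + k)) : R[i] :=
  (v 0 (lshift k j))%:C + (v 0 (rshift k j))%:C * 'i.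
pose phi (v : 'rV[R]_(k + k)) : 'cV[R[i]]_k :=
  \sum_(j < k) co j v *: delta_mx j 0.
have phic : continuous phi.
  apply: continuous_sum => j v.
  apply: (@continuousZr_tmp R[i] 'cV[R[i]]_k _ (co j)).
  apply: continuousD; last apply: continuousM; last exact: cst_continuous.
  - apply: (@continuous_comp _ _ _ (fun v : 'rV[R]_(k + k) => v 0 (lshift k j))
      (real_complex R)); first exact: coord_continuous.
    exact: continuous_real_complex.
  - apply: (@continuous_comp _ _ _ (fun v : 'rV[R]_(k + k) => v 0 (rshift k j))
      (real_complex R)); first exact: coord_continuous.
    exact: continuous_real_complex.
have phiE v j : phi v j 0 = v 0 (lshift k j) +i* v 0 (rshift k j).
  rewrite summxE (bigD1 j) //= big1 => [|i ij].
    rewrite !mxE !eqxx mulr1 addr0 /co; apply/eqP; rewrite eq_complex /=.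
    by rewrite !(mulr0, mulr1, mul0r, subr0, addr0, add0r) !eqxx.
  by rewrite !mxE eq_sym (negbTE ij) mulr0.
pose A := phi @^-1` @sphere_set m.
have -> : @sphere_set m = phi @` A.
  apply/seteqP; split => [z zS|_ [v vA <-] //].
  pose v : 'rV[R]_(k + k) := row_mx (\row_j complex.Re (z j 0))
                                     (\row_j complex.Im (z j 0)).
  have vz : phi v = z.
    apply/matrixP => i j; rewrite ord1 phiE row_mxEl row_mxEr !mxE.
    by case: (z i 0).
  by exists v => //; rewrite /A /= vz.
apply: continuous_compact; first exact: continuous_subspaceT.
apply: bounded_closed_compact.
  exists 1; split; first exact: real1.
  move=> M M1 v vA /=; apply: le_trans (ltW M1).
  have v1 j : v 0 (lshift k j) ^+ 2 + v 0 (rshift k j) ^+ 2 <= 1.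
    have : \sum_(i < k) normc (phi v i 0) ^+ 2 = 1.
      rewrite -[LHS]sqr_sqrtr; last by apply: sumr_ge0 => i _; exact: sqr_ge0.
      by rewrite [Num.sqrt _]vA expr1n.
    rewrite (bigD1 j) //= phiE /= sqr_sqrtr ?addr_ge0 ?sqr_ge0 // => <-.
    by rewrite lerDl sumr_ge0 // => i _; exact: sqr_ge0.
  rewrite [leLHS]mx_normrE; apply/bigmax_leP; split => // -[i j] _ /=.
  rewrite ord1 -(@expr_le1 _ 2) // real_normK ?num_real //.
  case: (split_ordP j) => l ->; apply: le_trans (v1 l).
    by rewrite lerDl sqr_ge0.
  by rewrite lerDr sqr_ge0.
apply: preimage_closed => [v _|]; first exact: phic.
rewrite (_ : @sphere_set m = (@l2norm k) @^-1` [set 1]) //.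
apply: preimage_closed (@closed_eq R 1) => z _.
exact: continuous_l2norm.
Qed.

Definition unitary_group m : Type :=
  {U : 'M[R[i]]_m.+1 | U \is unitarymx}.

Lemma l2norm_sqrE n (z : 'cV[R[i]]_n) :
  (\sum_(i < n) normc (z i 0) ^+ 2)%:C = (map_mx (@conjc R) z^T *m z) 0 0.
Proof.
rewrite rmorph_sum /= mxE; apply: eq_bigr => i _.
by rewrite !mxE rmorphXn /= -normr_normc sqr_normc mulrC.
Qed.

Lemma unitary_l2norm m (U : unitary_group m) (z : 'cV[R[i]]_m.+1) :
  l2norm (\val U *m z) = l2norm z.
Proof.
congr Num.sqrt; apply: complexI; rewrite !l2norm_sqrE.
have /unitarymxP/mulmx1C UU := valP U.
rewrite trmx_mul map_mxM -!mulmxA [X in _ *m X]mulmxA.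
by rewrite (_ : _ *m \val U = 1%:M) ?mul1mx // -UU.
Qed.

Lemma l2norm_rot m (U : unitary_group m) (z : csphere m) :
  l2norm (\val U *m vec z) = 1.
Proof. by rewrite unitary_l2norm csphereP. Qed.

Definition rot m (U : unitary_group m) (z : csphere m) : csphere m :=
  to_csphere (l2norm_rot U z).

Lemma vec_continuous m : continuous (@vec m).
Proof. exact: initial_continuous. Qed.

Lemma rot_continuous m (U : unitary_group m) : continuous (rot U).
Proof.
apply: continuous_comp_initial.
rewrite (_ : _ \o _ = fun z : csphere m =>
    \sum_(j < m.+1) vec z j 0 *: col j (\val U)); last first.
  apply/funext => z; apply/colP => i; rewrite [LHS]mxE summxE.
  by apply: eq_bigr => j _; rewrite !mxE mulrC.
apply: continuous_sum => j z.
apply: (@continuousZr_tmp R[i] 'cV[R[i]]_m.+1 _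
  (fun z : csphere m => vec z j 0)).
apply: (@continuous_comp _ _ _ (@vec m)
  (fun z : 'cV[R[i]]_m.+1 => z j 0)); first exact: vec_continuous.
exact: coord_continuous.
Qed.

HB.instance Definition _ m (U : unitary_group m) :=
  @isContinuous.Build (csphere m) (csphere m) (rot U) (@rot_continuous m U).

End CSphere.

Section ContinuousFunctions.
Context (R : realType) (m : nat).

(* A fresh alias of [continuousType], which already carries the compact-open
   topology in the library; here the topology is that of the supremum norm. *)
Definition Csphere : Type := continuousType (csphere R m) R[i].

HB.instance Definition _ := Choice.copy Csphere
  (continuousType (csphere R m) R[i]).

Implicit Types f g : Csphere.

Lemma CsphereP f g : (forall x, f x = g x) -> f = g.
Proof. by move=> fg; apply/continuousEP. Qed.

Lemma Csphere_cts f : continuous f.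
Proof. exact: (@cts_fun _ _ f). Qed.

Lemma add_cts f g : continuous (fun x => f x + g x).
Proof. by move=> x; apply: continuousD; exact: Csphere_cts. Qed.

Lemma opp_cts f : continuous (fun x => - f x).
Proof. by move=> x; apply: continuousN; exact: Csphere_cts. Qed.

Lemma scale_cts (a : R[i]) f : continuous (fun x => a * f x).
Proof. by move=> x; apply: continuousM; [exact: (@cst_continuous _ _ a)|exact: Csphere_cts]. Qed.

Definition Cadd f g : Csphere := mkcts (@add_cts f g).
Definition Copp f : Csphere := mkcts (@opp_cts f).
Definition Czero : Csphere := cst (0 : R[i]).
Definition Cscale (a : R[i]) f : Csphere := mkcts (@scale_cts a f).

Lemma CaddA : associative Cadd.
Proof. by move=> f g h; apply: CsphereP => x; exact: addrA. Qed.
Lemma CaddC : commutative Cadd.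
Proof. by move=> f g; apply: CsphereP => x; exact: addrC. Qed.
Lemma Cadd0 : left_id Czero Cadd.
Proof. by move=> f; apply: CsphereP => x; exact: add0r. Qed.
Lemma CaddN : left_inverse Czero Copp Cadd.
Proof. by move=> f; apply: CsphereP => x; exact: addNr. Qed.

HB.instance Definition _ := GRing.isZmodule.Build Csphere CaddA CaddC Cadd0 CaddN.

Lemma CscaleA a b f : Cscale a (Cscale b f) = Cscale (a * b) f.
Proof. by apply: CsphereP => x; exact: mulrA. Qed.
Lemma Cscale1 : left_id 1 Cscale.
Proof. by move=> f; apply: CsphereP => x; exact: mul1r. Qed.
Lemma CscaleDr : right_distributive Cscale +%R.
Proof. by move=> a f g; apply: CsphereP => x; exact: mulrDr. Qed.
Lemma CscaleDl f : {morph Cscale^~ f : a b / a + b}.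
Proof. by move=> a b; apply: CsphereP => x; exact: mulrDl. Qed.

HB.instance Definition _ := GRing.Zmodule_isLmodule.Build R[i] Csphere
  CscaleA Cscale1 CscaleDr CscaleDl.

Definition supnorm f : R := sup (range (fun x => normc (f x))).

Lemma Csphere_bounded f : has_sup (range (fun x => normc (f x))).
Proof.
split; first by exists (normc (f point)), point.
pose g (z : csphere R m) := normc (f z).
have gc : continuous g.
  move=> z; apply: (@continuous_comp _ _ _ f (@normc R)).
    exact: Csphere_cts.
  exact: continuous_normc.
have /(@subspace_valL_continuousP _ (@sphere_set R m)) gc' := gc.
have /compact_bounded[M [Mr gM]] := continuous_compact gc' (@sphere_set_compact R m).
exists (M + 1) => _ [z _ <-]; apply: le_trans (ler_norm _) _.
apply: (gM (M + 1)); first by rewrite ltrDl.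
exists (vec z); first exact: csphereP.
by have := congr1 (fun h => h z) (valLK point g).
Qed.

Lemma normc_le_supnorm f x : normc (f x) <= supnorm f.
Proof. by apply: ub_le_sup; [case: (Csphere_bounded f) | exists x]. Qed.

Lemma supnorm_le f c : (forall x, normc (f x) <= c) -> supnorm f <= c.
Proof.
move=> fc; apply: ge_sup; first by case: (Csphere_bounded f).
by move=> _ [x _ <-].
Qed.

Lemma supnormD f g : (supnorm (f + g))%:C <= (supnorm f)%:C + (supnorm g)%:C.
Proof.
rewrite -rmorphD lecR; apply: supnorm_le => x.
apply: (le_trans (le_normcD (f x) (g x))).
by apply: lerD; exact: normc_le_supnorm.
Qed.

Lemma supnormZ (a : R[i]) f : (supnorm (a *: f))%:C = `|a| * (supnorm f)%:C.
Proof.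
rewrite normr_normc -rmorphM; congr (_%:C); apply/eqP; rewrite eq_le.
apply/andP; split.
  apply: supnorm_le => x; rewrite [X in normc X](_ : _ = a * f x) // normcM.
  by rewrite ler_wpM2l ?normc_ge0 ?normc_le_supnorm.
have [->|a0] := eqVneq a 0.
  by rewrite normc0 mul0r; apply: le_trans (normc_le_supnorm _ (e1 R m));
    exact: normc_ge0.
have na0 : 0 < normc a.
  by rewrite lt_neqAle normc_ge0 andbT eq_sym; apply: contra_neq a0 => /eq0_normc.
rewrite mulrC -ler_pdivlMr //; apply: supnorm_le => x.
rewrite ler_pdivlMr // mulrC -normcM; exact: (normc_le_supnorm (a *: f) x).
Qed.

Lemma supnorm0_eq0 f : (supnorm f)%:C = 0 :> R[i] -> f = 0.
Proof.
move=> /complexI f0; apply: CsphereP => x; apply: eq0_normc; apply/eqP.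
by rewrite eq_le normc_ge0 andbT -f0 normc_le_supnorm.
Qed.

HB.instance Definition _ := Lmodule_isNormed.Build R[i] Csphere
  supnormD supnormZ supnorm0_eq0.

Definition comp_rot f (U : unitary_group R m) : Csphere := f \o rot U.

End ContinuousFunctions.

Section ProjectionConstants.
Context (R : realType).
Local Open Scope ereal_scope.

Definition rnorm (V : normedModType R[i]) (x : V) : R := complex.Re `|x|%R.

Definition op_norm (V W : normedModType R[i]) (T : V -> W) : \bar R :=
  ereal_sup [set (rnorm (T x))%:E | x in [set x : V | (rnorm x <= 1)%R]].

Definition bounded_projection (Y : normedModType R[i]) (X : set Y)
    (P : Y -> Y) : Prop :=
  [/\ linear P, op_norm P < +oo, (forall y, X (P y)) &
      (forall x, X x -> P x = x)].

(* equal to +oo when X is not complemented in Y *)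
Definition rel_proj_const (Y : normedModType R[i]) (X : set Y) : \bar R :=
  ereal_inf [set op_norm P | P in bounded_projection X].

(* Only the restriction of I to the linear subspace X matters. *)
Definition isometric_embedding (V : normedModType R[i]) (X : set V)
    (Y : normedModType R[i]) (I : V -> Y) : Prop :=
  (forall (a : R[i]) x y, X x -> X y -> I (a *: x + y)%R = (a *: I x + I y)%R)
  /\ (forall x, X x -> `|I x|%R = `|x|%R).

(* The absolute projection constant of the subspace X of V, normed by the
   restriction of the norm of V; Y ranges over all complex Banach spaces. *)
Definition proj_const (V : normedModType R[i]) (X : set V) : \bar R :=
  ereal_sup [set r | exists (Y : completeNormedModType R[i]) (I : V -> Y),
    isometric_embedding X I /\ r = rel_proj_const (I @` X)].

Definition finite_dim_subspace (V : lmodType R[i]) (X : set V) : Prop :=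
  exists (d : nat) (e : 'I_d -> V),
    X = [set (\sum_(i < d) c i *: e i)%R | c in [set: 'I_d -> R[i]]].

End ProjectionConstants.

Section Accessible.
Context (R : realType) (m : nat).

Definition borel_csphere := g_sigma_algebraType (@open (csphere R m)).

(* Among Borel probability measures on the sphere, invariance under the unitary
   group, which acts transitively, characterizes the normalized
   rotation-invariant measure. *)
Definition rotation_invariant (sigma : probability borel_csphere R) : Prop :=
  forall (U : unitary_group R m) (A : set borel_csphere),
    measurable A -> sigma (rot U @^-1` A) = sigma A.

Definition unitary_invariant (S : set (Csphere R m)) : Prop :=
  forall f (U : unitary_group R m), S f -> S (comp_rot f U).

Variable sigma : probability borel_csphere R.

Definition Cintegral (f : csphere R m -> R[i]) : R[i] :=
  (\int[sigma]_x complex.Re (f x)) +i* (\int[sigma]_x complex.Im (f x)).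

Definition square_integrable (f : csphere R m -> R[i]) : Prop :=
  [/\ measurable_fun [set: borel_csphere] (fun x => complex.Re (f x)),
      measurable_fun [set: borel_csphere] (fun x => complex.Im (f x)) &
      (\int[sigma]_x ((normc (f x)) ^+ 2)%:E < +oo)%E].

Definition L2inner (f g : csphere R m -> R[i]) : R[i] :=
  Cintegral (fun x => f x * (g x)^*).

(* The orthogonal projection onto the finite-dimensional subspace S: the element
   g of S such that f - g is orthogonal to S. *)
Definition orthoproj (S : set (Csphere R m)) (f : csphere R m -> R[i]) :
    Csphere R m :=
  xget 0 [set g : Csphere R m |
    S g /\ forall h : Csphere R m, S h -> L2inner (fun x => f x - g x) h = 0].

Definition orthoprojC (S : set (Csphere R m)) (f : Csphere R m) :
  Csphere R m := orthoproj S f.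

Definition repr_kernel (S : set (Csphere R m)) :
    csphere R m * csphere R m -> R[i] :=
  xget (cst 0) [set k : csphere R m * csphere R m -> R[i] |
    continuous k /\
    forall f, square_integrable f ->
      forall x, orthoproj S f x = Cintegral (fun y => f y * (k (x, y))^*)].

Definition accessible (S : set (Csphere R m)) : Prop :=
  unitary_invariant S /\
  unique (fun Q : Csphere R m -> Csphere R m =>
      bounded_projection S Q /\
      forall f (U : unitary_group R m), Q (comp_rot f U) = comp_rot (Q f) U)
    (orthoprojC S).

End Accessible.

(* Main.v *)
(* Let K be the sphere, k the reproducing kernel of S and c the integral of
   |k(x, .)|, which does not depend on x since k is invariant and the unitary
   group is transitive. Clearly |pi_S| <= c.

   Conversely every projection P of C(K) onto S has norm at least c, by trace
   duality. Let V be the integral operator with kernel v close to conj k / |k|;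
   v is obtained from a polynomial in k and conj k, so it is invariant,
   Hermitian, bounded by 1 and a finite sum of products a(x) b(y). Since
   pi_S + pi_S V (1 - pi_S) is a projection onto S commuting with rotations,
   accessibility forces pi_S V (1 - pi_S) = 0, whence V maps S into S. Thus V
   and P V have the same trace on S; that of V is the integral of v k, nearly c,
   and that of P V is the integral of (P v(., y))(y), at most |P|. No averaging
   over the unitary group is needed.

   Finally, if S embeds isometrically into Y, the functionals f |-> f(x) extend
   to Y by Hahn-Banach, and gluing finitely many of them with a partition of
   unity gives an almost extension Y -> C(K) of the inverse embedding, of norm
   at most 1; composing with pi_S yields projections of norm at most c + eta. *)
Require Import Defs.
From HB Require Import structures.
From mathcomp Require Import all_boot all_order all_algebra.
From mathcomp Require Import complex.
From mathcomp Require Import all_classical all_reals all_analysis.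
From mathcomp Require Import measurable_realfun ring lra.
Import numFieldNormedType.Exports.
Import Order.TTheory GRing.Theory Num.Theory ComplexField.Normc.

Set Implicit Arguments.
Unset Strict Implicit.
Unset Printing Implicit Defensive.

Local Open Scope classical_set_scope.
Local Open Scope ring_scope.
Local Open Scope complex_scope.

(* Plain [rot] would be [seq.rot]. *)
Local Notation rot := Defs.rot.
(* The operands of a product are parsed in [ring_scope], where this notation
   already means [Num.conj]; on R[i] it is convertible to [conjc]. *)
Local Notation "x ^*" := (Num.conj x) : complex_scope.

(** * The Hahn-Banach theorem *)

Section HahnBanach.
Context (R : realType) (V : lmodType R).

(* An extension of a functional is represented by its graph, a linear subspace
   of V * R; being dominated by p makes such a subspace the graph of a
   function. *)
Definition lin_rel (G : set (V * R)) := forall (r : R) u v,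
  G u -> G v -> G (r *: u.1 + v.1, r * u.2 + v.2).

Definition dominated (p : V -> R) (G : set (V * R)) :=
  forall u, G u -> u.2 <= p u.1.

(** Domination asks the value at [w] to lie above every [v.2 - p (v.1 - w)] and below every
    [p (u.1 + w) - u.2]. Subadditivity of [p] separates the two families, so the supremum of the
    first is a valid choice. *)
Lemma dominated_extension_step (p : V -> R) (G : set (V * R)) (w : V) :
  (forall u v, p (u + v) <= p u + p v) ->
  (forall r u, 0 <= r -> p (r *: u) = r * p u) ->
  G (0, 0) -> lin_rel G -> dominated p G ->
  exists a : R, dominated p
    [set u | exists v r, G v /\ u = (v.1 + r *: w, v.2 + r * a)].
Proof.
move=> pD pZ G0 Gl Gd.
pose A := [set v.2 - p (v.1 - w) | v in G].
have Gopp u v : G u -> G v -> u.2 + v.2 <= p (u.1 + v.1).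
  by move=> Gu Gv; have := Gd _ (Gl 1 _ _ Gu Gv); rewrite /= scale1r mul1r.
have Aub u : G u -> ubound A (p (u.1 + w) - u.2).
  move=> Gu _ [v Gv <-]; have := Gopp _ _ Gu Gv.
  have := pD (u.1 + w) (v.1 - w); rewrite addrACA subrr addr0; lra.
have hA : has_sup A.
  split; first by exists (0 - p (0 - w)), (0, 0).
  by exists (p (0 + w) - 0); exact: (Aub (0, 0)).
exists (sup A) => _ [v [r [Gv ->]]] /=.
have GZ s : G (s *: v.1, s * v.2).
  by have := Gl s _ _ Gv G0; rewrite /= !addr0.
(* Homogeneity reduces the bound to r = -1 or r = 1, where it is one of the two sides of the
   supremum. *)
have [r0|r0|->] := ltgtP r 0; last by rewrite scale0r mul0r !addr0; exact: Gd.
- have nr0 : 0 < - r by rewrite oppr_gt0.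
  have h : (- r)^-1 * v.2 - p ((- r)^-1 *: v.1 - w) <= sup A.
    by apply: ub_le_sup; [case: hA | exists ((- r)^-1 *: v.1, (- r)^-1 * v.2)].
  have -> : v.1 + r *: w = (- r) *: ((- r)^-1 *: v.1 - w).
    by rewrite scalerBr scalerA divff ?scale1r ?gt_eqF // scaleNr opprK.
  rewrite pZ ?(ltW nr0) //; move: h; rewrite -(ler_pM2l nr0) mulrBr mulrA.
  rewrite divff ?mul1r ?gt_eqF //; lra.
- have h : sup A <= p (r^-1 *: v.1 + w) - r^-1 * v.2.
    apply: ge_sup; first by case: hA.
    exact: (Aub (r^-1 *: v.1, r^-1 * v.2)).
  have -> : v.1 + r *: w = r *: (r^-1 *: v.1 + w).
    by rewrite scalerDr scalerA divff ?scale1r ?gt_eqF.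
  rewrite pZ ?(ltW r0) //; move: h; rewrite -(ler_pM2l r0) mulrBr mulrA.
  rewrite divff ?mul1r ?gt_eqF //; lra.
Qed.

Theorem hahn_banach_graph (p : V -> R) (G0 : set (V * R)) :
  (forall u v, p (u + v) <= p u + p v) ->
  (forall r u, 0 <= r -> p (r *: u) = r * p u) ->
  G0 (0, 0) -> lin_rel G0 -> dominated p G0 ->
  exists f : V -> R,
    [/\ forall r u v, f (r *: u + v) = r * f u + f v,
        forall u, f u <= p u & forall u, G0 u -> f u.1 = u.2].
Proof.
move=> pD pZ G00 G0l G0d.
(* The empty chain has empty union, so containing [G0] is only demanded of nonempty relations. *)
pose P (G : set (V * R)) :=
  [/\ lin_rel G, dominated p G & G !=set0 -> G0 `<=` G].
have [|A [[Al Ad A0] Amax]] := @Zorn_bigcup _ P.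
  move=> F FP Ftot; split.
  - move=> r u v [X FX Xu] [Y FY Yv].
    have [Xl _ _] := FP _ FX; have [Yl _ _] := FP _ FY.
    have [XY|YX] := Ftot _ _ FX FY.
      by exists Y => //; apply: Yl => //; exact: XY.
    by exists X => //; apply: Xl => //; exact: YX.
  - by move=> u [X FX Xu]; have [_ Xd _] := FP _ FX; exact: Xd.
  - move=> [u [X FX Xu]] v Gv; exists X => //.
    by have [_ _ X0] := FP _ FX; apply: X0 => //; exists u.
(* A maximal relation is nonempty, since [G0] lies strictly above the empty one. *)
have {A0} GA : G0 `<=` A.
  have [/A0 //|A_eq0] := pselect (A !=set0).
  have : ~ P G0.
    apply: Amax; split=> [u Au|G0A]; first by case: A_eq0; exists u.
    by apply: A_eq0; exists (0, 0); exact: G0A.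
  by move=> nP; exfalso; apply: nP; split => // _ u.
have A00 : A (0, 0) by exact: GA.
(* By maximality the one-step extension along [w] adds nothing, so [w] is already in the domain. *)
have Atot w : exists a, A (w, a).
  have [a Ba] := dominated_extension_step w pD pZ A00 Al Ad.
  set B := [set u | _] in Ba.
  have AB : A `<=` B.
    by move=> u Au; exists u, 0;
      rewrite scale0r mul0r !addr0 -surjective_pairing.
  exists a; apply: contrapT => Awa; apply: (Amax B).
    split=> // BA; apply: Awa; apply: BA; exists (0, 0), 1.
    by rewrite /= scale1r mul1r !add0r.
  split => // [r _ _ [u [s [Au ->]]] [v [t [Av ->]]]|_].
    exists (r *: u.1 + v.1, r * u.2 + v.2), (r * s + t); split; first exact: Al.
    rewrite /= scalerDr mulrDr scalerA mulrA scalerDl mulrDl.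
    by rewrite addrACA [X in (_, X)]addrACA.
  exact: subset_trans AB.
(* Two values over [w] differ by a value over 0, which is at most [p 0 = 0]. *)
have Afun w a b : A (w, a) -> A (w, b) -> a = b.
  have aux c d : A (w, c) -> A (w, d) -> d <= c.
    move=> Ac Ad'; have := Ad _ (Al (-1) _ _ Ac Ad') => /=.
    by rewrite scaleN1r addNr -(scale0r (0 :
      V)) pZ // mul0r mulN1r addrC subr_le0.
  by move=> Aa Ab; apply/eqP; rewrite eq_le !aux.
have [f Af] := choice Atot.
exists f; split=> [r u v|u|u Gu]; [|exact: (Ad _ (Af u))|].
  by apply: (Afun _ _ _ (Af _)); exact: (Al r _ _ (Af u) (Af v)).
by apply: (Afun _ _ _ (Af _)); apply: GA; rewrite -surjective_pairing.
Qed.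

End HahnBanach.

(** * Integration of complex functions on the sphere *)

Section ComplexModulus.
Context (R : realType).
Implicit Type x : R[i].

Lemma normc_sqr x : normc x ^+ 2 = complex.Re x ^+ 2 + complex.Im x ^+ 2.
Proof. by case: x => a b /=; rewrite sqr_sqrtr // addr_ge0 ?sqr_ge0. Qed.

Lemma normr_Re_le x : `|complex.Re x| <= normc x.
Proof. by rewrite -lecR -normr_normc normc_ge_Re. Qed.

Lemma normr_Im_le x : `|complex.Im x| <= normc x.
Proof.
rewrite -(@ler_pXn2r _ 2) ?nnegrE ?normr_ge0 ?normc_ge0 //.
by rewrite real_normK ?num_real // normc_sqr lerDr sqr_ge0.
Qed.

Lemma normc_conjc x : normc x^* = normc x.
Proof. by case: x => a b /=; rewrite sqrrN. Qed.

Lemma normc_real (a : R) : normc a%:C = `|a|.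
Proof. by rewrite /= expr0n addr0 sqrtr_sqr. Qed.

Lemma normc_le_ReIm x : normc x <= `|complex.Re x| + `|complex.Im x|.
Proof.
rewrite [x in leLHS]complexE; apply: le_trans (le_normcD _ _) _.
rewrite normc_real normcM normc_real /= expr0n expr1n add0r sqrtr1 mul1r.
exact: lexx.
Qed.

Lemma mulc_conj x : x * x^* = (normc x ^+ 2)%:C.
Proof. by rewrite -sqr_normc normr_normc rmorphXn. Qed.

Lemma ReM_real (a : R) x : complex.Re (a%:C * x) = a * complex.Re x.
Proof. by case: x => c d /=; rewrite mul0r subr0. Qed.

Lemma Re_real (a : R) : complex.Re a%:C = a.
Proof. by []. Qed.

Lemma conjc_mul x (y : R[i]) : (x * y)^* = x^* * y^*.
Proof. exact: rmorphM. Qed.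

Lemma conjc_opp x : (- x)^* = - x^*.
Proof. exact: rmorphN. Qed.

Lemma conjc_add x (y : R[i]) : (x + y)^* = x^* + y^*.
Proof. exact: rmorphD. Qed.

Lemma conjc_conj x : x^*^* = x.
Proof. exact: conjCK. Qed.

Lemma conjc_one : (1 : R[i])^* = 1.
Proof. exact: rmorph1. Qed.

Lemma conjc_zero : (0 : R[i])^* = 0.
Proof. exact: rmorph0. Qed.

Lemma conjc_sub x (y : R[i]) : (x - y)^* = x^* - y^*.
Proof. exact: rmorphB. Qed.

Lemma continuous_lipschitz1 (K : numFieldType) (V W : normedModType K)
    (f : V -> W) :
  (forall u v, `|f u - f v| <= `|u - v|) -> continuous f.
Proof.
move=> fl u; apply/cvgrPdist_lt => e e0; near=> v.
apply: le_lt_trans (fl u v) _; near: v.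
exact: (@cvgr_dist_lt _ _ _ _ _ id).
Unshelve. all: by end_near. Qed.

Lemma continuous_conjc : continuous (fun x : R[i] => x^*).
Proof.
apply: (@continuous_lipschitz1 R[i] R[i] R[i]) => x y.
by rewrite -conjc_sub !normr_normc lecR normc_conjc.
Qed.

(** The source is normed over [R[i]] and the target over [R], so the Lipschitz argument is repeated
    across the two scalar fields. *)
Lemma continuous_to_real (f : R[i] -> R) :
  (forall x y, `|f x - f y| <= normc (x - y)) -> continuous f.
Proof.
move=> fl x A /nbhs_normP [e /= e0 eA].
apply/nbhs_normP; exists e%:C => [|y /= h]; first by rewrite /= ltcR.
apply: eA => /=; apply: le_lt_trans (fl x y) _.
by rewrite -ltcR.
Qed.

Lemma continuous_Re : continuous (@complex.Re R : R[i] -> R).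
Proof.
apply: continuous_to_real => -[a b] [c d].
exact: (normr_Re_le ((a +i* b) - (c +i* d))).
Qed.

Lemma continuous_Im : continuous (@complex.Im R : R[i] -> R).
Proof.
apply: continuous_to_real => -[a b] [c d].
exact: (normr_Im_le ((a +i* b) - (c +i* d))).
Qed.

End ComplexModulus.

Section Integration.
Context (R : realType) (m : nat).
Variable sigma : probability (borel_csphere R m) R.
Notation T := (csphere R m).
Notation C := (Csphere R m).
Implicit Types (f g : T -> R[i]) (u v : T -> R).

Lemma continuous_borel_measurable u :
  continuous u -> measurable_fun [set: borel_csphere R m] u.
Proof.
move=> /continuousP cu; apply: (measurability _ (RGenOpens.measurableE R)).
move=> _ [_ [a [b ->] <-]]; rewrite setTI; apply: sub_sigma_algebra.
exact/cu/interval_open.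
Qed.

Lemma real_complex_cts u :
  continuous u -> continuous (fun x => (u x)%:C : R[i]).
Proof.
move=> cu x; apply: (@continuous_comp _ _ _ u (real_complex R)).
  exact: cu.
exact: (@continuous_real_complex R).
Qed.

Lemma continuous_bounded_csphere u : continuous u ->
  exists M, forall x, `|u x| <= M.
Proof.
move=> cu; pose f : C := mkcts (real_complex_cts cu).
by exists (supnorm f) => x; rewrite -normc_real; exact: (normc_le_supnorm f).
Qed.

Lemma continuous_integrable u : continuous u ->
  sigma.-integrable [set: borel_csphere R m] (EFin \o u).
Proof.
move=> cu; have [M uM] := continuous_bounded_csphere cu.
apply: measurable_bounded_integrable => //.
- by rewrite [X in (X < _)%E](@probability_setT _ _ _ sigma) ltry.
- exact: continuous_borel_measurable.
- exists M; split; first exact: num_real.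
  by move=> N MN x _ /=; apply: le_trans (uM x) (ltW MN).
Qed.

Definition Cintegrable f :=
  sigma.-integrable [set: borel_csphere R m]
    (EFin \o (fun x => complex.Re (f x))) /\
  sigma.-integrable [set: borel_csphere R m]
    (EFin \o (fun x => complex.Im (f x))).

Lemma continuous_Cintegrable f : continuous f -> Cintegrable f.
Proof.
move=> cf; split; apply: continuous_integrable => x.
  by apply: continuous_comp; [exact: cf | exact: continuous_Re].
by apply: continuous_comp; [exact: cf | exact: continuous_Im].
Qed.

Let mT := @measurableT _ (borel_csphere R m).

Lemma CintegralD f g : Cintegrable f -> Cintegrable g ->
  Cintegral sigma (fun x => f x + g x) = Cintegral sigma f + Cintegral sigma g.
Proof.
move=> [f1 f2] [g1 g2]; rewrite /Cintegral.
rewrite [RHS](_ : _ =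
  (\int[sigma]_x complex.Re (f x) + \int[sigma]_x complex.Re (g x)) +i*
  (\int[sigma]_x complex.Im (f x) + \int[sigma]_x complex.Im (g x))) //.
rewrite -!RintegralD //; congr (_ +i* _); apply: eq_Rintegral => x _;
  by case: (f x) (g x) => [? ?] [? ?].
Qed.

Let integrableZ u (r : R) :
  sigma.-integrable [set: borel_csphere R m] (EFin \o u) ->
  sigma.-integrable [set: borel_csphere R m] (EFin \o (fun x => r * u x)).
Proof. by move=> /(integrableZl mT r). Qed.

Lemma CintegrableZ (c : R[i]) f : Cintegrable f ->
  Cintegrable (fun x => c * f x).
Proof.
case: c => a b [f1 f2]; split.
  apply: eq_integrable (integrableD mT (integrableZ a f1) (integrableZ (- b)
    f2)) => // x _ /=.
  by case: (f x) => [? ?] /=; rewrite -EFinD mulNr.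
apply: eq_integrable (integrableD mT (integrableZ a f2) (integrableZ b f1)) =>
  // x _ /=.
by case: (f x) => [? ?] /=; rewrite -EFinD.
Qed.

Lemma CintegralZ (c : R[i]) f : Cintegrable f ->
  Cintegral sigma (fun x => c * f x) = c * Cintegral sigma f.
Proof.
case: c => a b [f1 f2]; rewrite /Cintegral.
rewrite [RHS](_ : _ =
  (a * \int[sigma]_x complex.Re (f x) + (- b) * \int[sigma]_x complex.Im (f x))
    +i*
  (a * \int[sigma]_x complex.Im (f x) + b * \int[sigma]_x complex.Re (f x)));
    last first.
  by rewrite mulNr.
rewrite -!RintegralZl // -!RintegralD //; try exact: integrableZ.
congr (_ +i* _); apply: eq_Rintegral => x _; case: (f x) => [? ?] //=.
by rewrite mulNr.
Qed.

Lemma Cintegral_conj f : Cintegrable f ->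
  Cintegral sigma (fun x => (f x)^*) = (Cintegral sigma f)^*.
Proof.
move=> [_ f2]; congr (_ +i* _); first by apply: eq_Rintegral => x _;
  case: (f x).
rewrite -[RHS]mulN1r -RintegralZl //; apply: eq_Rintegral => x _.
by case: (f x) => [? ?] /=; rewrite mulN1r.
Qed.

Lemma Cintegral_cst (c : R[i]) : Cintegral sigma (fun=> c) = c.
Proof.
rewrite /Cintegral !Rintegral_cst // [X in fine X]probability_setT !mulr1.
by case: c.
Qed.

Lemma Re_Cintegral f :
  complex.Re (Cintegral sigma f) = \int[sigma]_x complex.Re (f x).
Proof. by []. Qed.

Lemma normc_Cintegral_le f (u : T -> R) : Cintegrable f ->
  sigma.-integrable [set: borel_csphere R m] (EFin \o u) ->
  (forall x, normc (f x) <= u x) ->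
    normc (Cintegral sigma f) <= \int[sigma]_x u x.
Proof.
move=> fi ui fu; set z := Cintegral _ _.
have [z0|z0] := eqVneq z 0.
  by rewrite z0 normc0; apply: Rintegral_ge0 => x _; apply: le_trans (fu x);
    exact: normc_ge0.
have nz : 0 < normc z.
  by rewrite lt_neqAle normc_ge0 andbT eq_sym;
    apply: contra_neq z0 => /eq0_normc.
(* The unimodular [c] rotates the integral onto its modulus; then only the real part of [c * f x],
   bounded by [u x], is integrated. *)
pose c := ((normc z)^-1)%:C * z^*.
have cz : c * z = (normc z)%:C.
  rewrite /c -mulrA [_ * z]mulrC mulc_conj -rmorphM /= expr2 mulrA mulVf ?mul1r
    //.
  by rewrite gt_eqF.
have nc : normc c = 1.
  by rewrite /c normcM normc_real normc_conjc ger0_norm ?invr_ge0 ?normc_ge0 //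
    mulVf ?gt_eqF.
have -> : normc z = complex.Re (Cintegral sigma (fun x => c * f x)).
  by rewrite CintegralZ // -/z cz.
rewrite Re_Cintegral; apply: le_Rintegral => //;
  first by case: (CintegrableZ c fi).
move=> x _; apply: le_trans (ler_norm _) _; apply: le_trans (normr_Re_le _) _.
by rewrite normcM nc mul1r.
Qed.

End Integration.

(** * The unitary group and the topology of the sphere *)

Section UnitaryGroup.
Context (R : realType) (m : nat).
Notation T := (csphere R m).
Implicit Types (U : unitary_group R m) (x y z : T).

Definition unitary_of (M : 'M[R[i]]_m.+1) (uM : M \is unitarymx) :
  unitary_group R m := exist (fun M => M \is unitarymx) M uM.

Definition unitary_inv U : unitary_group R m :=
  unitary_of (etrans (trmxC_unitary (val U)) (valP U)).

Lemma vec_inj x y : vec x = vec y -> x = y.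
Proof. by move=> xy; exact: val_inj. Qed.

Lemma vec_rot U x : vec (rot U x) = val U *m vec x.
Proof. by rewrite /vec /set_val /=. Qed.

Lemma rotK U : cancel (rot U) (rot (unitary_inv U)).
Proof.
move=> x; apply: vec_inj; rewrite !vec_rot mulmxA.
by have /unitarymxP/mulmx1C -> := valP U; rewrite mul1mx.
Qed.

Lemma rotVK U : cancel (rot (unitary_inv U)) (rot U).
Proof.
move=> x; apply: vec_inj; rewrite !vec_rot mulmxA.
by have /unitarymxP -> := valP U; rewrite mul1mx.
Qed.

Lemma csphere_norm x : map_mx (@conjc R) (vec x)^T *m vec x = 1%:M.
Proof.
apply/matrixP => i j; rewrite !ord1 -l2norm_sqrE.
have := csphereP x; rewrite /l2norm => /(congr1 (fun r => r ^+ 2)).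
rewrite sqr_sqrtr ?expr1n; first by move=> ->; rewrite mxE eqxx.
by apply: sumr_ge0 => k _; exact: sqr_ge0.
Qed.

(* The unitary map taking x to y is the complex Householder reflection
   1 - w w^* / (w^* x) along w = x - y. *)
Lemma unitary_transitive x y : exists U, rot U x = y.
Proof.
have adj n p q (A : 'M[R[i]]_(n, p)) (B : 'M[R[i]]_(p, q)) :
    map_mx (@conjc R) (A *m B)^T = map_mx (@conjc R) B^T *m map_mx (@conjc R)
      A^T.
  by rewrite trmx_mul map_mxM.
have adjK n p (A : 'M[R[i]]_(n, p)) :
  map_mx (@conjc R) (map_mx (@conjc R) A^T)^T = A.
  by apply/matrixP => i j; rewrite !mxE conjcK.
have [->|xy] := eqVneq x y.
  have I1 : (1%:M : 'M[R[i]]_m.+1) \is unitarymx.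
    by apply/unitarymxP; rewrite mul1mx trmx1 map_mx1.
  by exists (unitary_of I1); apply: vec_inj; rewrite vec_rot mul1mx.
have subE (A B : 'M[R[i]]_1) : (A - B) 0 0 = A 0 0 - B 0 0.
  by rewrite mxE [X in _ + X]mxE.
pose w := vec x - vec y; pose ws := map_mx (@conjc R) w^T.
pose a := (ws *m vec x) 0 0.
pose b := (map_mx (@conjc R) (vec y)^T *m vec x) 0 0.
have wsE : ws = map_mx (@conjc R) (vec x)^T - map_mx (@conjc R) (vec y)^T.
  by rewrite /ws linearB /= map_mxB.
have aE : a = 1 - b.
  by rewrite /a wsE mulmxBl csphere_norm subE; congr (_ - _); rewrite mxE.
have aJ : conjc a = 1 - conjc b.
  by rewrite aE; apply: etrans (conjc_sub 1 b) _; congr (_ - _);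
    exact: conjc_one.
have bc : (map_mx (@conjc R) (vec x)^T *m vec y) 0 0 = conjc b.
  rewrite -[vec y in LHS]adjK -adj [LHS]mxE; congr conjc.
  by rewrite [LHS]mxE.
(* This identity, which uses that x and y have norm 1, makes the reflection unitary; it also shows
   that a = 0 would force w = 0. *)
have wwE : (ws *m w) 0 0 = a + conjc a.
  rewrite wsE mulmxBl !mulmxBr !csphere_norm aJ aE !subE bc -/b.
  by rewrite [1%:M 0 0]mxE eqxx mulr1n; ring.
have a0 : a != 0.
  apply: contra_neq xy => a0; apply: vec_inj; apply/eqP; rewrite -subr_eq0.
  apply/eqP; rewrite -/w.
  have : \sum_(i < m.+1) normc (w i 0) ^+ 2 = 0.
    by apply: complexI; rewrite l2norm_sqrE -/ws wwE a0 [conjc _]conjc_zero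
      addr0.
  move/psumr_eq0P => w0; apply/matrixP => i j; rewrite ord1 [RHS]mxE.
  apply: eq0_normc; apply/eqP; rewrite -sqrf_eq0; apply/eqP;
    apply: w0 => // k _.
  exact: sqr_ge0.
pose U : 'M[R[i]]_m.+1 := 1%:M - a^-1 *: (w *m ws).
have Us : map_mx (@conjc R) U^T = 1%:M - (conjc a)^-1 *: (w *m ws).
  rewrite /U linearB /= map_mxB trmx1 map_mx1 linearZ /= map_mxZ adj adjK.
  by congr (_ - _ *: _); exact: conjc_inv.
have ww1 : ws *m w = (a + conjc a)%:M.
  by apply/matrixP => i j; rewrite !ord1 wwE !mxE eqxx.
have Uu : U \is unitarymx.
  apply/unitarymxP; rewrite Us mulmxBr mulmx1 mulmxBl mul1mx.
  rewrite -!scalemxAl -!scalemxAr mulmxA -[w *m ws *m w]mulmxA ww1.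
  rewrite mul_mx_scalar -!scalemxAl !scalerA -addrA -opprD -scalerBl -scalerDl.
  rewrite [X in X *: _](_ : _ = 0) ?scale0r ?subr0 //.
  have ac0 : conjc a != 0 by rewrite conjc_eq0.
  by field; rewrite a0 ac0.
exists (unitary_of Uu); apply: vec_inj; rewrite vec_rot [val _]/=.
rewrite mulmxBl mul1mx -scalemxAl -mulmxA.
have -> : ws *m vec x = a%:M.
  by apply/matrixP => i j; rewrite !ord1 [RHS]mxE eqxx mulr1n.
by rewrite mul_mx_scalar scalerA mulVf // scale1r /w subKr.
Qed.

(** The topology is induced by [vec]: a cluster point of the image filter in the compact set
    [sphere_set] is the image of a cluster point of the filter itself. *)
Lemma csphere_compact : compact [set: T].
Proof.
move=> F FF _.
have FS : (@vec R m @ F) (@sphere_set R m).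
  by apply: (@filterS _ F _ setT) filterT => x _; exact: (csphereP x).
have [p [pS clp]] := @sphere_set_compact R m (@vec R m @ F) _ FS.
exists (to_csphere pS); split=> // A B FA.
rewrite /nbhs /= => -[B1 [[W oW <-] Wp] B1B].
have FvA : (@vec R m @ F) (@vec R m @` A).
  by apply: (@filterS _ F _ A) FA => x Ax; exists x.
have [_ [[x Ax <-] Wx]] := clp _ W FvA (open_nbhs_nbhs (conj oW Wp)).
by exists x; split => //; exact: B1B.
Qed.

(** The open sets where [w x] is positive cover the sphere, and a finite subcover suffices. This
    serves both the full support of the measure and the partition of unity. *)
Lemma csphere_finite_positive (w : T -> T -> R) :
  (forall x, continuous (w x)) -> (forall x z, 0 <= w x z) ->
  (forall x, 0 < w x x) ->
  exists s : seq T, forall z, 0 < \sum_(x <- s) w x z.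
Proof.
move=> wc w0 wp; have := csphere_compact; rewrite compact_cover.
move=> /(_ T setT (fun x => [set z | 0 < w x z])).
case=> [x _|z _|D _ Dcov].
- rewrite [X in open X](_ : _ = w x @^-1` [set r | 0 < r]) //.
  by apply: open_comp; [move=> z _; exact: wc | exact: open_gt].
- by exists z => //=.
exists (finmap.enum_fset D) => z; have [x /= Dx wxz] := Dcov z I.
rewrite (big_rem x) //= ltr_wpDr // sumr_ge0 // => y _; exact: w0.
Qed.

End UnitaryGroup.

(** * The inner product *)

Section InnerProduct.
Context (R : realType) (m : nat).
Variable sigma : probability (borel_csphere R m) R.
Hypothesis sigma_inv : rotation_invariant sigma.
Notation T := (csphere R m).
Notation C := (Csphere R m).
Implicit Types (a b : R[i]) (f g h : C) (F G : T -> R[i]).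
Implicit Type U : unitary_group R m.
Notation L := (Cintegral sigma).
Notation ip := (L2inner sigma).

Lemma Csphere_evalD f g x : (f + g) x = f x + g x. Proof. by []. Qed.

Lemma Csphere_evalB f g x : (f - g) x = f x - g x. Proof. by []. Qed.

Lemma Csphere_evalZ a f x : (a *: f) x = a * f x. Proof. by []. Qed.

Lemma Csphere_eval_sum (I : Type) (r : seq I) (e : I -> C) x :
  (\sum_(i <- r) e i) x = \sum_(i <- r) e i x.
Proof.
elim: r => [|i r IH]; first by rewrite !big_nil.
by rewrite !big_cons Csphere_evalD IH.
Qed.

Lemma mul_cts f g : continuous (fun x => f x * g x).
Proof. by move=> x; apply: continuousM; exact: Csphere_cts. Qed.

Lemma conj_cts f : continuous (fun x => (f x)^*).
Proof.
move=> x; apply: (@continuous_comp _ _ _ f (fun z : R[i] => z^*));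
  first exact: Csphere_cts.
exact: (@continuous_conjc R).
Qed.

Definition Cmul f g : C := mkcts (@mul_cts f g).
Definition Cconj f : C := mkcts (@conj_cts f).
Definition Cone : C := cst (1 : R[i]).

Lemma Cintegrable_C f : Cintegrable sigma f.
Proof. by apply: continuous_Cintegrable; exact: Csphere_cts. Qed.

Lemma normc_C_cts f : continuous (fun x => normc (f x)).
Proof.
move=> x; apply: (@continuous_comp _ _ _ f (@normc R));
  first exact: Csphere_cts.
exact: (@continuous_normc R).
Qed.

Lemma Cintegral_lin a f g : L (a *: f + g) = a * L f + L g.
Proof.
rewrite -CintegralZ; last exact: Cintegrable_C.
by rewrite -CintegralD //;
  [exact: (Cintegrable_C (a *: f)) | exact: Cintegrable_C].
Qed.

Lemma Cintegral_sum (I : Type) (r : seq I) (c : I -> R[i]) (e : I -> C) :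
  L (\sum_(i <- r) c i *: e i) = \sum_(i <- r) c i * L (e i).
Proof.
elim: r => [|i r IH]; last by rewrite !big_cons Cintegral_lin IH.
by rewrite !big_nil; exact: (Cintegral_cst sigma 0).
Qed.

(** The first factor is merely integrable, as needed to project square-integrable functions; the
    second is continuous, hence bounded. *)
Lemma Cintegrable_mul F g : Cintegrable sigma F ->
  Cintegrable sigma (fun x => F x * g x).
Proof.
move=> [F1 F2].
have bnd (u : T -> R) : continuous u ->
    [bounded u x | x in [set: borel_csphere R m]].
  move=> uc; have [M uM] := continuous_bounded_csphere uc.
  exists M; split; first exact: num_real.
  by move=> N MN x _ /=; apply: le_trans (uM x) (ltW MN).
have cRe : continuous (fun x => complex.Re (g x)).
  by move=> x; apply: continuous_comp;
    [exact: (@Csphere_cts R m g) | exact: continuous_Re].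
have cIm : continuous (fun x => complex.Im (g x)).
  by move=> x; apply: continuous_comp;
    [exact: (@Csphere_cts R m g) | exact: continuous_Im].
have mT := @measurableT _ (borel_csphere R m).
have M (u v : T -> R) :
  sigma.-integrable [set: borel_csphere R m] (EFin \o u) ->
    continuous v ->
    sigma.-integrable [set: borel_csphere R m] (EFin \o (fun x => u x * v x)).
  move=> ui vc; have := integrableMl mT ui (continuous_borel_measurable vc)
    (bnd v vc).
  by apply: eq_integrable.
split.
  apply: eq_integrable (integrableB mT (M _ _ F1 cRe) (M _ _ F2 cIm)) =>
    // x _ /=.
  by case: (F x) (g x) => [? ?] [? ?].
apply: eq_integrable (integrableD mT (M _ _ F1 cIm) (M _ _ F2 cRe)) =>
  // x _ /=.
by case: (F x) (g x) => [? ?] [? ?].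
Qed.

Lemma ipDl F G h : Cintegrable sigma F -> Cintegrable sigma G ->
  ip (fun x => F x + G x) h = ip F h + ip G h.
Proof.
move=> Fi Gi; rewrite /L2inner -CintegralD;
  try exact: (@Cintegrable_mul _ (Cconj h)).
by congr Cintegral; apply/funext => x; rewrite mulrDl.
Qed.

Lemma ipZl a F h : Cintegrable sigma F -> ip (fun x => a * F x) h = a * ip F h.
Proof.
move=> Fi; rewrite /L2inner -CintegralZ;
  last exact: (@Cintegrable_mul _ (Cconj h)).
by congr Cintegral; apply/funext => x; rewrite mulrA.
Qed.

Lemma ipBl F G h : Cintegrable sigma F -> Cintegrable sigma G ->
  ip (fun x => F x - G x) h = ip F h - ip G h.
Proof.
move=> Fi Gi; rewrite -[X in _ + X]mulN1r -ipZl // -ipDl //.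
  by congr L2inner; apply/funext => x; rewrite mulN1r.
exact: CintegrableZ.
Qed.

Lemma ip_linl a f g h : ip (a *: f + g) h = a * ip f h + ip g h.
Proof.
have := @ipDl (a *: f) g h (Cintegrable_C _) (Cintegrable_C _) => ->.
by rewrite (@ipZl a f h (Cintegrable_C _)).
Qed.

Lemma ip_sym F h : Cintegrable sigma F -> ip h F = (ip F h)^*.
Proof.
move=> Fi; rewrite /L2inner -Cintegral_conj;
  last exact: (@Cintegrable_mul _ (Cconj h)).
by congr Cintegral; apply/funext => x; rewrite conjc_mul conjc_conj mulrC.
Qed.

Lemma ip_symC f g : ip g f = (ip f g)^*.
Proof. by apply: ip_sym; exact: Cintegrable_C. Qed.

Lemma ip_suml (I : Type) (r : seq I) (c : I -> R[i]) (e : I -> C) h :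
  ip (\sum_(i <- r) c i *: e i) h = \sum_(i <- r) c i * ip (e i) h.
Proof.
elim: r => [|i r IH]; last by rewrite !big_cons ip_linl IH.
rewrite !big_nil -(subrr (0 : C)) -scaleN1r addrC ip_linl mulN1r.
by rewrite addNr.
Qed.

Lemma ip_linr a F g h : Cintegrable sigma F ->
  ip F (a *: g + h) = a^* * ip F g + ip F h.
Proof.
move=> Fi; have Mi f := @Cintegrable_mul _ (Cconj f) Fi.
rewrite /L2inner -CintegralZ; last exact: Mi.
rewrite -CintegralD; [|by apply: CintegrableZ; exact: Mi|exact: Mi].
congr Cintegral; apply/funext => x.
rewrite Csphere_evalD Csphere_evalZ conjc_add conjc_mul; ring.
Qed.

Lemma ip_sumr (I : Type) (r : seq I) (c : I -> R[i]) (e : I -> C) F :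
  Cintegrable sigma F ->
  ip F (\sum_(i <- r) c i *: e i) = \sum_(i <- r) (c i)^* * ip F (e i).
Proof.
move=> Fi; elim: r => [|i r IH]; last by rewrite !big_cons ip_linr // IH.
rewrite !big_nil -(subrr (0 : C)) -scaleN1r addrC ip_linr //.
by rewrite conjc_opp conjc_one mulN1r addNr.
Qed.

Lemma ip_ge0 f : ip f f = (\int[sigma]_x (normc (f x) ^+ 2))%:C.
Proof.
rewrite /L2inner /Cintegral; under eq_Rintegral do rewrite mulc_conj.
congr (_ +i* _); under eq_Rintegral do rewrite mulc_conj.
by rewrite Rintegral_cst // mul0r.
Qed.

Lemma normc_ip_le f g : normc (ip f g) <= supnorm f * supnorm g.
Proof.
have bi : sigma.-integrable [set: borel_csphere R m]
    (EFin \o (fun=> supnorm f * supnorm g)).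
  by apply: continuous_integrable => x; exact: cst_continuous.
apply: le_trans (normc_Cintegral_le _ bi _) _.
- exact: (@Cintegrable_mul f (Cconj g) (Cintegrable_C _)).
- move=> x; rewrite normcM normc_conjc.
  by apply: ler_pM; rewrite ?normc_ge0 ?normc_le_supnorm.
by rewrite Rintegral_cst // [X in fine X]probability_setT mulr1.
Qed.

(** Invariance says that the pushforward of [sigma] under the rotation is [sigma]; the rest is the
    change of variables for pushforwards. *)
Lemma Rintegral_rot (u : T -> R) U : continuous u ->
  \int[sigma]_x u (rot U x) = \int[sigma]_x u x.
Proof.
move=> uc.
pose r : borel_csphere R m -> borel_csphere R m := rot U.
have mr : measurable_fun setT r.
  apply: (@measurability _ _ (borel_csphere R m) (borel_csphere R m) setT r
    (@open T)) => // _ [A oA <-].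
  rewrite setTI; apply: sub_sigma_algebra; apply: open_comp oA => x _;
    exact: rot_continuous.
have mu := measurable_int _ (continuous_integrable sigma uc).
have iu : sigma.-integrable (r @^-1` setT) ((EFin \o u) \o r).
  apply: (@continuous_integrable _ _ sigma (fun x => u (rot U x))) => x.
  by apply: continuous_comp; [exact: rot_continuous | exact: uc].
have := integral_pushforward mr mu iu measurableT.
rewrite preimage_setT /Rintegral => <-; congr fine.
by apply: eq_measure_integral => A mA _; exact: sigma_inv.
Qed.

Lemma Cintegral_rot f U : L (comp_rot f U) = L f.
Proof.
congr (_ +i* _).
  apply: (@Rintegral_rot (fun x => complex.Re (f x))) => x.
  by apply: continuous_comp;
    [exact: (@Csphere_cts R m f) | exact: continuous_Re].
apply: (@Rintegral_rot (fun x => complex.Im (f x))) => x.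
by apply: continuous_comp; [exact: (@Csphere_cts R m f) | exact: continuous_Im].
Qed.

Lemma ip_rot f g U : ip (comp_rot f U) (comp_rot g U) = ip f g.
Proof. exact: (Cintegral_rot (Cmul f (Cconj g)) U). Qed.

(** The measure has full support: if u were positive at x0, finitely many rotated copies of u would
    have a sum bounded below by a positive constant, although each of them has integral 0. *)
Lemma Rintegral_eq0_continuous (u : T -> R) : continuous u ->
  (forall x, 0 <= u x) -> \int[sigma]_x u x = 0 -> forall x, u x = 0.
Proof.
move=> uc u0 iu0 x0; apply/eqP; apply: contrapT => /negP ux0.
have {ux0} ux0 : 0 < u x0 by rewrite lt_neqAle eq_sym ux0 u0.
have /choice[V Vx] := fun x => @unitary_transitive R m x x0.
have vc x : continuous (fun z => u (rot (V x) z)).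
  by move=> z; apply: continuous_comp; [exact: rot_continuous | exact: uc].
have [|x|s sp] := @csphere_finite_positive R m (fun x z => u (rot (V x) z)) vc.
- by move=> x z; exact: u0.
- by rewrite Vx.
pose h z := \sum_(x <- s) u (rot (V x) z).
have hc : continuous h.
  apply: (@continuous_sum R T R) => x; exact: vc.
(* A bound M of 1/h is a positive lower bound 1/M of h. *)
have [M hM] : exists M, forall z, `|(h z)^-1| <= M.
  by apply: continuous_bounded_csphere => z; apply: continuousV;
    [rewrite gt_eqF ?sp|exact: hc].
have ih : \int[sigma]_z h z = 0.
  rewrite /h; elim: (s) => [|x r IH].
    by under eq_Rintegral do rewrite big_nil; rewrite Rintegral_cst // mul0r.
  under eq_Rintegral do rewrite big_cons.
  rewrite RintegralD //; first by rewrite IH addr0 Rintegral_rot.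
    exact: continuous_integrable.
  by apply: continuous_integrable; apply: (@continuous_sum R T R).
have M0 : 0 < M.
  by apply: lt_le_trans (hM x0); rewrite normr_gt0 invr_neq0 // gt_eqF ?sp.
have : M^-1 <= \int[sigma]_z h z.
  rewrite -[leLHS]mulr1 -[X in _ * X](_ : fine (sigma setT) = 1); last first.
    by rewrite probability_setT.
  rewrite -Rintegral_cst //; apply: le_Rintegral => //.
  - by apply: continuous_integrable => x; exact: cst_continuous.
  - exact: continuous_integrable.
  - move=> z _; have hz : 0 < h z by exact: sp.
    rewrite -[leRHS]invrK lef_pV2 ?posrE ?invr_gt0 //.
    exact: le_trans (ler_norm _) (hM z).
by rewrite ih leNgt invr_gt0 M0.
Qed.

Lemma ip_eq0 f : ip f f = 0 -> f = 0.
Proof.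
rewrite ip_ge0 => /complexI f0; apply: CsphereP => x; apply: eq0_normc.
apply/eqP; rewrite -sqrf_eq0; apply/eqP.
apply: (@Rintegral_eq0_continuous (fun x => normc (f x) ^+ 2)) => // [z|z].
  apply: (@continuous_comp _ _ _ (fun z => normc (f z)) (fun r => r ^+ 2)).
    exact: normc_C_cts.
  exact: exprn_continuous.
exact: sqr_ge0.
Qed.

End InnerProduct.

(** * Integral operators with separable kernels *)

Section SeparableKernels.
Context (R : realType) (m : nat).
Variable sigma : probability (borel_csphere R m) R.
Hypothesis sigma_inv : rotation_invariant sigma.
Notation T := (csphere R m).
Notation C := (Csphere R m).
Implicit Types (a b : R[i]) (f g h : C) (U : unitary_group R m).
Notation L := (Cintegral sigma).
Notation ip := (L2inner sigma).

(* Finite sums of products a(x) b(y), for which Fubini's theorem is mere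
   linearity. *)
Definition sep_kernel (s : seq (C * C)) (x y : T) : R[i] :=
  \sum_(p <- s) p.1 x * p.2 y.

Definition separable (v : T -> T -> R[i]) := exists s, v = sep_kernel s.

Lemma separable_ext v w : (forall x y, v x y = w x y) -> separable w ->
  separable v.
Proof. by move=> vw [s ws]; exists s; rewrite -ws; apply/funext => x;
  apply/funext => y. Qed.

Lemma separable_pair f g : separable (fun x y => f x * g y).
Proof.
by exists [:: (f, g)]; apply/funext => x; apply/funext => y;
  rewrite /sep_kernel big_seq1.
Qed.

Lemma separableD v w : separable v -> separable w -> separable (fun x y =>
  v x y + w x y).
Proof.
move=> [s ->] [t ->]; exists (s ++ t); apply/funext => x; apply/funext => y.
by rewrite /sep_kernel big_cat.
Qed.

Lemma separable_sum (I : Type) (r : seq I) (v : I -> T -> T -> R[i]) :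
  (forall i, separable (v i)) -> separable (fun x y => \sum_(i <- r) v i x y).
Proof.
move=> vs; elim: r => [|i r IH].
  exists [::]; apply/funext => x; apply/funext => y.
  by rewrite /sep_kernel !big_nil.
apply: separable_ext (separableD (vs i) IH) => x y.
by rewrite big_cons.
Qed.

Lemma separableM v w : separable v -> separable w -> separable (fun x y =>
  v x y * w x y).
Proof.
move=> [s ->] [t ->].
apply: (@separable_ext _ (fun x y => \sum_(p <- s) \sum_(q <- t)
    (Cmul p.1 q.1) x * (Cmul p.2 q.2) y)).
  move=> x y; rewrite /sep_kernel big_distrl; apply: eq_bigr => p _.
  by rewrite big_distrr; apply: eq_bigr => q _; rewrite /= mulrACA.
apply: separable_sum => p; apply: separable_sum => q; exact: separable_pair.
Qed.

Lemma separable_conj v : separable v -> separable (fun x y => (v x y)^*).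
Proof.
move=> [s ->]; apply: (@separable_ext _ (fun x y => \sum_(p <- s)
    (Cconj p.1) x * (Cconj p.2) y)).
  move=> x y; rewrite /sep_kernel (big_morph _ (fun x y =>
    @conjc_add R x y) (@conjc_zero R)).
  by apply: eq_bigr => p _; rewrite conjc_mul.
apply: separable_sum => p; exact: separable_pair.
Qed.

Lemma separable_cst a : separable (fun _ _ => a).
Proof.
apply: separable_ext (separable_pair (a *: Cone R m) (Cone R m)) => x y.
by rewrite Csphere_evalZ !mulr1.
Qed.

(** The integral operator with kernel [sep_kernel s], expanded so that its values are continuous by
    construction and linear maps can be applied to it termwise. *)
Definition kernel_op (s : seq (C * C)) f : C :=
  \sum_(p <- s) L (fun y => f y * p.2 y) *: p.1.

Lemma kernel_opE s f x : kernel_op s f x = L (fun y => f y * sep_kernel s x y).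
Proof.
rewrite /kernel_op Csphere_eval_sum.
transitivity (L (\sum_(p <- s) p.1 x *: (Cmul f p.2))).
  by rewrite Cintegral_sum; apply: eq_bigr => p _; rewrite Csphere_evalZ mulrC.
congr Cintegral; apply/funext => y; rewrite Csphere_eval_sum big_distrr.
by apply: eq_bigr => p _; rewrite Csphere_evalZ /= mulrCA.
Qed.

Lemma kernel_op_linear s : linear (kernel_op s).
Proof.
move=> a f g; rewrite /kernel_op scaler_sumr -big_split;
  apply: eq_bigr => p _ /=.
rewrite scalerA -scalerDl; congr (_ *: _).
have := Cintegral_lin sigma a (Cmul f p.2) (Cmul g p.2) => <-.
by congr Cintegral; apply/funext => y;
  rewrite !Csphere_evalD !Csphere_evalZ /= mulrDl mulrA.
Qed.

Lemma sep_kernel_cts s x : continuous (sep_kernel s x).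
Proof.
apply: (@continuous_sum R[i] T R[i] (C * C)%type s (fun p y =>
  p.1 x * p.2 y)) => p.
exact: scale_cts.
Qed.

Lemma separable_fubini v : separable v ->
  L (fun x => L (fun y => v x y)) = L (fun y => L (fun x => v x y)).
Proof.
move=> [s ->].
have E1 x : L (sep_kernel s x) = (\sum_(p <- s) L p.2 *: p.1) x.
  transitivity (L (\sum_(p <- s) p.1 x *: p.2)).
    by congr Cintegral; apply/funext => y; rewrite Csphere_eval_sum.
  rewrite Cintegral_sum Csphere_eval_sum; apply: eq_bigr => p _.
  by rewrite Csphere_evalZ mulrC.
have E2 y : L (fun x => sep_kernel s x y) = (\sum_(p <- s) L p.1 *: p.2) y.
  transitivity (L (\sum_(p <- s) p.2 y *: p.1)).
    congr Cintegral; apply/funext => x; rewrite Csphere_eval_sum.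
    by apply: eq_bigr => p _; rewrite Csphere_evalZ mulrC.
  rewrite Cintegral_sum Csphere_eval_sum; apply: eq_bigr => p _.
  by rewrite Csphere_evalZ mulrC.
transitivity (L (\sum_(p <- s) L p.2 *: p.1)).
  by congr Cintegral; apply/funext => x; rewrite E1.
transitivity (L (\sum_(p <- s) L p.1 *: p.2)); last first.
  by congr Cintegral; apply/funext => x; rewrite E2.
by rewrite !Cintegral_sum; apply: eq_bigr => p _; rewrite mulrC.
Qed.

(** The substitution of U y for y in the integral moves the rotation from the function to the
    kernel. *)
Lemma kernel_op_rot s U f :
  (forall x y, sep_kernel s (rot U x) (rot U y) = sep_kernel s x y) ->
  kernel_op s (comp_rot f U) = comp_rot (kernel_op s f) U.
Proof.
move=> sU; apply: CsphereP => x.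
rewrite [RHS](_ : _ = kernel_op s f (rot U x)) // !kernel_opE.
pose k : C := mkcts (@sep_kernel_cts s (rot U x)).
rewrite [RHS](_ : _ = L (Cmul f k)) // -(Cintegral_rot sigma_inv _ U).
by congr Cintegral; apply/funext => y; rewrite -(sU x y).
Qed.

(** Both sides are the double integral of f(y) s(x, y) conj g(x): a Hermitian kernel gives a
    self-adjoint operator by Fubini. *)
Lemma kernel_op_adjoint s f g :
  (forall x y, (sep_kernel s y x)^* = sep_kernel s x y) ->
  ip (kernel_op s f) g = ip f (kernel_op s g).
Proof.
move=> sJ; pose w x y := f y * sep_kernel s x y * (g x)^*.
have ws : separable w.
  have A := separable_pair (Cone R m) f.
  have B := separable_pair (Cconj g) (Cone R m).
  apply: separable_ext (separableM (separableM A _) B) => [x y|].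
    by rewrite /w /= mul1r mulr1.
  by exists s.
transitivity (L (fun x => L (fun y => w x y))).
  congr Cintegral; apply/funext => x; rewrite kernel_opE mulrC.
  pose k : C := mkcts (@sep_kernel_cts s x).
  rewrite -(CintegralZ _ (Cintegrable_C sigma (Cmul f k))).
  by congr Cintegral; apply/funext => y; rewrite /= mulrC.
rewrite separable_fubini //; congr Cintegral; apply/funext => y.
rewrite kernel_opE; pose k : C := mkcts (@sep_kernel_cts s y).
rewrite -(Cintegral_conj (Cintegrable_C sigma (Cmul g k))).
rewrite -(CintegralZ _ (Cintegrable_C sigma (Cconj (Cmul g k)))).
congr Cintegral; apply/funext => x.
rewrite [in RHS](_ : Cconj _ x = (g x * sep_kernel s y x)^*) // conjc_mul sJ /w.
ring.
Qed.

End SeparableKernels.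

(** * Completeness of the space of continuous functions *)

Section Completeness.
Context (R : realType) (m : nat).
Notation T := (csphere R m).
Notation C := (Csphere R m).

(** Real and imaginary parts are 1-Lipschitz, so they send the Cauchy filter to Cauchy filters of
    [R], and the two limits give the complex one. *)
Lemma complex_complete (F : set_system R[i]) :
  ProperFilter F -> cauchy F -> cvg F.
Proof.
move=> FF Fc.
have aux (p : R[i] -> R) : (forall x y, `|p x - p y| <= normc (x - y)) ->
    cvg (p @ F).
  move=> pl; apply: cauchy_cvg; apply/cauchy_ballP => e e0.
  have /cauchy_ballP /(_ e%:C) := Fc;
    rewrite ltcR => /(_ e0) [[A B] /= [FA FB] AB].
  exists (p @` A, p @` B) => /=.
    by split; [apply: filterS FA | apply: filterS FB] => x; exists x.
  move=> [_ _] /= [[x Ax <-] [y By <-]].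
  have := AB (x, y) (conj Ax By); rewrite /= -ball_normE /= normr_normc ltcR.
  exact: le_lt_trans.
have /cvg_ex[a Fa] : cvg (@complex.Re R @ F).
  by apply: aux => -[a b] [c d]; exact: (normr_Re_le ((a +i* b) - (c +i* d))).
have /cvg_ex[b Fb] : cvg (@complex.Im R @ F).
  by apply: aux => -[a' b] [c d]; exact: (normr_Im_le ((a' +i* b) - (c +i* d))).
apply/cvg_ex; exists (a +i* b); apply/cvgrPdist_lt => e e0.
have eR : e = (complex.Re e)%:C by rewrite RRe_real // gtr0_real.
have e2 : 0 < complex.Re e / 2 by rewrite divr_gt0 // -ltcR -eR.
move/cvgrPdist_lt: Fa => /(_ _ e2); move/cvgrPdist_lt: Fb => /(_ _ e2).
rewrite !near_simpl => B A; near=> x.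
rewrite eR normr_normc ltcR; apply: le_lt_trans (normc_le_ReIm _) _.
rewrite [complex.Re e]splitr; apply: ltrD.
  have -> : complex.Re (a +i* b - x) = a - complex.Re x by case: (x).
  by near: x.
have -> : complex.Im (a +i* b - x) = b - complex.Im x by case: (x).
by near: x.
Unshelve. all: by end_near. Qed.

Lemma continuous_uniform_approx (X : topologicalType) (g : X -> R[i]) :
  (forall e : R, 0 < e -> exists f : X -> R[i],
     continuous f /\ forall x, normc (f x - g x) <= e) ->
  continuous g.
Proof.
move=> gf x; apply/cvgrPdist_lt => e e0.
have eR : e = (complex.Re e)%:C by rewrite RRe_real // gtr0_real.
have e4 : 0 < complex.Re e / 4 by rewrite divr_gt0 // -ltcR -eR.
have [f [fc fg]] := gf _ e4.
have e4c : 0 < (complex.Re e / 4)%:C :> R[i] by rewrite ltcR.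
have /cvgrPdist_lt /(_ _ e4c) := fc x.
apply: filterS => y; rewrite eR !normr_normc !ltcR => fxy.
have -> : g x - g y = - (f x - g x) + (f x - f y) + (f y - g y) by ring.
apply: le_lt_trans (le_normcD _ _) _.
have := le_normcD (- (f x - g x)) (f x - f y); rewrite normcN => h.
have := fg x; have := fg y; have : 0 < complex.Re e by lra.
lra.
Qed.

(** Completeness makes the space of continuous functions itself an admissible superspace in
    [proj_const]. The limit is taken pointwise, shown to be uniform, and is therefore continuous. *)
Lemma Csphere_complete (F : set_system C) : ProperFilter F -> cauchy F -> cvg F.
Proof.
move=> FF /cauchy_ballP Fc.
(* The Cauchy condition compares members of A with members of B; two members of A are compared
   through a common h0 in B. *)
have FcR (e : R) : 0 < e -> exists A, F A /\
    forall f h, A f -> A h -> forall x, normc (f x - h x) <= e.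
  move=> e0; have [|[A B] /= [FA FB] AB] := Fc (e / 2)%:C.
    by rewrite ltcR divr_gt0.
  have [h0 Bh0] := filter_ex FB.
  exists A; split => // f h Af Ah x.
  have H u : A u -> normc (u x - h0 x) < e / 2.
    move=> Au; have := AB (u, h0) (conj Au Bh0).
    rewrite /= -ball_normE /= ltcR; apply: le_lt_trans.
    exact: (normc_le_supnorm (u - h0) x).
  have -> : f x - h x = (f x - h0 x) + - (h x - h0 x) by ring.
  apply: le_trans (le_normcD _ _) _; rewrite normcN.
  have := H _ Af; have := H _ Ah; lra.
have Fx x : cvg ((fun f : C => f x) @ F).
  apply: complex_complete; apply/cauchy_ballP => e e0.
  have eR : e = (complex.Re e)%:C by rewrite RRe_real // gtr0_real.
  have e2 : 0 < complex.Re e / 2 by rewrite divr_gt0 // -ltcR -eR.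
  have [A [FA Ad]] := FcR _ e2.
  exists ((fun f : C => f x) @` A, (fun f : C => f x) @` A) => /=.
    by split; apply: (@filterS _ F _ A) => // f Af; exists f.
  move=> [_ _] /= [[f Af <-] [h Ah <-]]; rewrite -ball_normE /= eR.
  rewrite normr_normc ltcR; apply: le_lt_trans (Ad _ _ Af Ah x) _; lra.
pose g x : R[i] := lim ((fun f : C => f x) @ F).
have Fg (e : R) : 0 < e -> F [set f : C | forall x, normc (f x - g x) <= e].
  move=> e0; have e2 : 0 < e / 2 by rewrite divr_gt0.
  have [A [FA Ad]] := FcR _ e2.
  apply: (@filterS _ F _ A _ _ FA) => f Af x.
  have e2c : 0 < (e / 2)%:C :> R[i] by rewrite ltcR.
  have /cvgrPdist_lt /(_ _ e2c) := Fx x; rewrite near_simpl => Fgx.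
  have [h [Ah hg]] := filter_ex (filterI FA Fgx).
  have -> : f x - g x = (f x - h x) + - (g x - h x) by ring.
  apply: le_trans (le_normcD _ _) _; rewrite normcN.
  move: hg; rewrite /= normr_normc ltcR => hg.
  have := Ad _ _ Af Ah x; lra.
have gc : continuous g.
  apply: continuous_uniform_approx => e e0.
  have [f fg] := @filter_ex _ F FF _ (Fg e e0).
  by exists f; split; [exact: (@Csphere_cts R m f) | exact: fg].
apply/cvg_ex; exists (mkcts gc : C); apply/cvgrPdist_le => e e0.
have eR : e = (complex.Re e)%:C by rewrite RRe_real // gtr0_real.
have e1 : 0 < complex.Re e by rewrite -ltcR -eR.
have := Fg _ e1; apply: filterS => f fg; rewrite eR lecR.
by apply: supnorm_le => x; rewrite -normcN opprB; exact: fg.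
Qed.

HB.instance Definition _ := Uniform_isComplete.Build C Csphere_complete.

Definition Csphere_banach : completeNormedModType R[i] := C.

End Completeness.

(** * Parseval frames and the reproducing kernel *)

Lemma continuous_pair_left (X Y : topologicalType) (x : X) :
  continuous (fun y : Y => (x, y)).
Proof. by move=> y; apply: cvg_pair => //=; exact: cvg_cst. Qed.

Section Frames.
Context (R : realType) (m : nat).
Variable sigma : probability (borel_csphere R m) R.
Hypothesis sigma_inv : rotation_invariant sigma.
Notation T := (csphere R m).
Notation C := (Csphere R m).
Implicit Types (a b : R[i]) (f g h : C) (F : T -> R[i]) (U : unitary_group R m).
Notation L := (Cintegral sigma).
Notation ip := (L2inner sigma).

Definition fproj (s : seq C) F : C := \sum_(e <- s) ip F e *: e.

(** The expansion formula of an orthonormal basis, asked of a finite list of members of S;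
    projection, kernel and trace are all computed from it. *)
Definition parseval_frame (S : set C) (s : seq C) :=
  (forall e, e \in s -> S e) /\ (forall f, S f -> f = fproj s f).

Definition lin_closed (S : set C) :=
  S 0 /\ forall a f g, S f -> S g -> S (a *: f + g).

Lemma lin_closed_sum (S : set C) (s : seq C) (c : C -> R[i]) : lin_closed S ->
  (forall e, e \in s -> S e) -> S (\sum_(e <- s) c e *: e).
Proof.
move=> [S0 Sl]; elim: s => [|e s IH] sS; first by rewrite big_nil.
rewrite big_cons; apply: Sl; first by apply: sS; rewrite mem_head.
by apply: IH => k ks; apply: sS; rewrite inE ks orbT.
Qed.

Lemma fproj_linear s : linear (fun f : C => fproj s f).
Proof.
move=> a f g; rewrite /fproj scaler_sumr -big_split; apply: eq_bigr => e _ /=.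
by rewrite ip_linl scalerDl scalerA.
Qed.

Lemma ip_fproj S s F h : parseval_frame S s -> S h -> Cintegrable sigma F ->
  ip (fproj s F) h = ip F h.
Proof.
move=> [_ sf] Sh Fi; rewrite [in RHS](sf h Sh) ip_sumr // ip_suml.
by apply: eq_bigr => e _; rewrite -ip_symC mulrC.
Qed.

Lemma ip_sub_fproj S s F h : parseval_frame S s -> S h -> Cintegrable sigma F ->
  ip (fun x => F x - fproj s F x) h = 0.
Proof.
move=> sf Sh Fi; rewrite ipBl //; last exact: Cintegrable_C.
by rewrite (ip_fproj sf) // subrr.
Qed.

Lemma finite_dim_lin_closed (S : set C) : finite_dim_subspace S -> lin_closed S.
Proof.
move=> [d [e ->]]; split.
  by exists (fun=> 0) => //; apply: big1 => i _; rewrite scale0r.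
move=> a _ _ [c1 _ <-] [c2 _ <-]; exists (fun i => a * c1 i + c2 i) => //.
rewrite scaler_sumr -big_split; apply: eq_bigr => i _ /=.
by rewrite scalerDl scalerA.
Qed.

(* Gram-Schmidt *)
Lemma finite_dim_frame (S : set C) : finite_dim_subspace S ->
  exists s, parseval_frame S s.
Proof.
move=> [d [e ->]]; elim: d e => [|d IH] e.
  exists [::]; split => // f [c _ <-].
  by rewrite /fproj big_ord0 big_nil.
pose e' i := e (widen_ord (leqnSn d) i).
have [s sf] := IH e'; set X := [set _ | c in _] in sf.
set Y := [set _ | c in _].
have Xl : lin_closed X by apply: finite_dim_lin_closed; exists d, e'.
have Yl : lin_closed Y by apply: finite_dim_lin_closed; exists d.+1, e.
have XY f : X f -> Y f.
  (* The coefficient of the last vector is set to 0. *)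
  move=> [c _ <-]; exists (fun i =>
    if unlift ord_max i is Some j then c j else 0) => //.
  rewrite big_ord_recr /= unlift_none scale0r addr0; apply: eq_bigr => i _;
    rewrite /e'.
  suff -> : widen_ord (leqnSn d) i = lift ord_max i by rewrite liftK.
  by apply: val_inj; rewrite /= /bump leqNgt ltn_ord.
have Ye : Y (e ord_max).
  exists (fun i => (i == ord_max)%:R) => //.
  rewrite (bigD1 ord_max) //= eqxx scale1r big1 ?addr0 // => i /negbTE ->.
  by rewrite scale0r.
(* The component of the last vector orthogonal to the span X of the earlier ones. *)
pose u := e ord_max - fproj s (e ord_max).
have Xp f : X (fproj s f) by apply: lin_closed_sum Xl _; case: sf.
have Yu : Y u.
  by rewrite /u addrC -scaleN1r; apply: Yl.2 => //; exact/XY/Xp.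
have uX h : X h -> ip u h = 0.
  by move=> Xh; exact: (ip_sub_fproj sf Xh (Cintegrable_C _ _)).
have Ydec f : Y f -> exists g c, X g /\ f = g + c *: u.
  move=> [c _ <-]; rewrite big_ord_recr /=; set g := \sum_(_ < _) _.
  exists (c ord_max *: fproj s (e ord_max) + g), (c ord_max); split.
    by apply: Xl.2; [exact: Xp | exists (fun i => c (widen_ord (leqnSn d) i))].
  rewrite /u scalerBr [RHS]addrC addrA subrK addrC.
  by rewrite /g.
(* The spanning family may be dependent: if the last vector already lies in X, the frame of X is
   kept. *)
have [u0|u0] := eqVneq u 0.
  exists s; split=> [k /(sf.1)/XY //|f /Ydec [g [c [Xg ->]]]].
  by rewrite u0 scaler0 addr0; exact: sf.2.
pose nu := \int[sigma]_x (normc (u x) ^+ 2).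
have uu : ip u u = nu%:C by exact: ip_ge0.
have nu0 : 0 < nu.
  rewrite lt_neqAle eq_sym; apply/andP; split.
    apply: contra_neq u0 => nu0; apply: (ip_eq0 sigma_inv).
    by rewrite uu nu0.
  by apply: Rintegral_ge0 => x _; exact: sqr_ge0.
pose r : R := (Num.sqrt nu)^-1.
have r2 : r%:C^* * r%:C * nu%:C = 1 :> R[i].
  rewrite (_ : r%:C^* = r%:C); last exact: conjc_real.
  rewrite -!rmorphM /= /r -invfM -expr2 sqr_sqrtr ?ltW // mulVf //.
  by rewrite gt_eqF.
exists (r%:C *: u :: s); split.
  move=> k; rewrite inE => /predU1P[->|/(sf.1)/XY //].
  by rewrite -[_ *: _]addr0; apply: Yl.2 => //; case: Yl.
move=> f /Ydec [g [c [Xg ->]]].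
have ru F : Cintegrable sigma F -> ip F (r%:C *: u) = r%:C^* * ip F u.
  move=> Fi; rewrite -[_ *: u]addr0 ip_linr //.
  have -> : ip F 0 = 0.
    by have := @ip_sumr R m sigma C [::] (fun=> 0) id F Fi; rewrite !big_nil.
  by rewrite addr0.
have gcu : g + c *: u = c *: u + g by rewrite addrC.
rewrite /fproj big_cons.
have -> : \sum_(j <- s) ip (g + c *: u) j *: j = g.
  rewrite [RHS](sf.2 g Xg) /fproj !big_seq; apply: eq_bigr => k ks.
  by rewrite gcu ip_linl uX ?mulr0 ?add0r //; exact: sf.1.
rewrite ru; last exact: Cintegrable_C.
rewrite gcu ip_linl uu (ip_symC sigma u g) uX // conjc_zero addr0.
rewrite scalerA; congr (_ *: u + g).
by rewrite -[LHS]mulr1 -r2; ring.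
Qed.

(** The frame expansion meets the defining condition of [orthoproj], so the choice made there is not
    the default. Two candidates differ by an element of S orthogonal to S, hence to itself. *)
Lemma orthoproj_frame S s F : lin_closed S -> parseval_frame S s ->
  Cintegrable sigma F ->
  orthoproj sigma S F = fproj s F.
Proof.
move=> Sl sf Fi.
have Sp : S (fproj s F) by apply: lin_closed_sum Sl _; case: sf.
have /(xgetPex 0) : exists g, [set g : C | S g /\
    forall h, S h -> ip (fun x => F x - g x) h = 0] g.
  by exists (fproj s F); split => // h Sh; exact: (ip_sub_fproj sf).
rewrite -/(orthoproj sigma S F); set g := orthoproj _ _ _ => -[Sg gF].
apply/eqP; rewrite -subr_eq0; apply/eqP; apply: (ip_eq0 sigma_inv).
have Sd : S (g - fproj s F) by rewrite addrC -scaleN1r; apply: Sl.2.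
have := gF _ Sd; rewrite ipBl //; last exact: Cintegrable_C.
rewrite -(ip_fproj sf Sd Fi) => /eqP; rewrite subr_eq0 => /eqP e.
have := @ipBl _ _ sigma g (fproj s F) (g - fproj s F) (Cintegrable_C _ _)
  (Cintegrable_C _ _).
by rewrite e subrr.
Qed.

(** Since t <= 1 + t^2 and the total mass is 1, both parts of F are dominated by an integrable
    function. *)
Lemma square_integrable_Cintegrable F : square_integrable sigma F ->
  Cintegrable sigma F.
Proof.
move=> [mRe mIm Foo].
have mT := @measurableT _ (borel_csphere R m).
have i2 : sigma.-integrable [set: borel_csphere R m] (EFin \o (fun x =>
  normc (F x) ^+ 2)).
  apply/integrableP; split.
    apply/measurable_EFinP; under eq_fun do rewrite normc_sqr.
    by apply: measurable_funD; apply: measurable_funX.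
  under eq_integral do rewrite /= ger0_norm ?sqr_ge0 //.
  exact: Foo.
have i1 : sigma.-integrable [set: borel_csphere R m] (EFin \o (fun=> 1 : R)).
  by apply: continuous_integrable => x; exact: cst_continuous.
have dom (u : T -> R) : measurable_fun [set: borel_csphere R m] u ->
    (forall x, `|u x| <= normc (F x)) ->
    sigma.-integrable [set: borel_csphere R m] (EFin \o u).
  move=> mu uF; apply: le_integrable (integrableD mT i1 i2) => //.
    exact/measurable_EFinP.
  move=> x _ /=; rewrite lee_fin [leRHS]ger0_norm ?addr_ge0 ?sqr_ge0 //.
  have := uF x; have := sqr_ge0 (normc (F x) - 1);
    have := sqr_ge0 (normc (F x)); nra.
split; apply: dom => // x; [exact: normr_Re_le | exact: normr_Im_le].
Qed.

Lemma square_integrable_C f : square_integrable sigma f.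
Proof.
have /integrableP[_] :
  sigma.-integrable [set: borel_csphere R m] (EFin \o (fun x =>
  normc (f x) ^+ 2)).
  apply: continuous_integrable => z.
  apply: (@continuous_comp _ _ _ (fun z => normc (f z)) (fun r => r ^+ 2)).
    exact: normc_C_cts.
  exact: exprn_continuous.
under eq_integral do rewrite /= ger0_norm ?sqr_ge0 //.
split=> //; apply: continuous_borel_measurable => x.
  by apply: continuous_comp;
    [exact: (@Csphere_cts R m f) | exact: continuous_Re].
by apply: continuous_comp; [exact: (@Csphere_cts R m f) | exact: continuous_Im].
Qed.

(** The function y -> k(x, y); pairing with it evaluates the projection at x. The conjugate sits on
    the first variable because [repr_kernel] is conjugated under the integral. *)
Definition frame_kernel (s : seq C) (x : T) : C := \sum_(e <- s) (e x)^* *: e.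

Lemma ip_frame_kernel s F x : Cintegrable sigma F ->
  ip F (frame_kernel s x) = fproj s F x.
Proof.
move=> Fi; rewrite ip_sumr // Csphere_eval_sum; apply: eq_bigr => e _.
by rewrite conjc_conj Csphere_evalZ mulrC.
Qed.

Lemma frame_kernel_sym s x y : frame_kernel s y x = (frame_kernel s x y)^*.
Proof.
rewrite !Csphere_eval_sum (big_morph _ (fun x y =>
  @conjc_add R x y) (@conjc_zero R)).
by apply: eq_bigr => e _; rewrite !Csphere_evalZ conjc_mul conjc_conj mulrC.
Qed.

Lemma frame_kernel_continuous s :
  continuous (fun p : T * T => frame_kernel s p.1 p.2).
Proof.
rewrite (_ : (fun _ => _) = fun p : T * T =>
  \sum_(e <- s) Cconj e p.1 * e p.2); last first.
  by apply/funext => p; rewrite Csphere_eval_sum.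
apply: (@continuous_sum R[i] (T * T)%type R[i]) => e p.
apply: (@continuousM _ (T * T)%type (fun p : T * T =>
  Cconj e p.1) (fun p : T * T => e p.2)).
  by apply: continuous_comp; [exact: cvg_fst | exact: Csphere_cts].
by apply: continuous_comp; [exact: cvg_snd | exact: Csphere_cts].
Qed.

(** The frame kernel shows that a kernel as required exists. For uniqueness, the difference d of two
    kernels at fixed x is continuous, and testing both on d itself gives [ip d d = 0]. *)
Lemma repr_kernelE S s x y : lin_closed S -> parseval_frame S s ->
  repr_kernel sigma S (x, y) = frame_kernel s x y.
Proof.
move=> Sl sf.
have /(xgetPex (cst 0)) : exists k, [set k : T * T -> R[i] | continuous k /\
    forall F, square_integrable sigma F ->
      forall x, orthoproj sigma S F x = L (fun y => F y * (k (x, y))^*)] k.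
  exists (fun p : T * T => frame_kernel s p.1 p.2); split.
    exact: frame_kernel_continuous.
  move=> F /square_integrable_Cintegrable Fi z.
  by rewrite (orthoproj_frame Sl sf) // -ip_frame_kernel.
rewrite -/(repr_kernel sigma S); move: (repr_kernel sigma S) => k [kc kS].
have kxc : continuous (fun y => k (x, y)).
  move=> z; apply: (@continuous_comp T (T * T)%type R[i] (fun y => (x, y)) k).
    exact: continuous_pair_left.
  exact: (kc (x, z)).
pose kx : C := mkcts kxc; pose d := kx - frame_kernel s x.
have : ip d kx = ip d (frame_kernel s x).
  rewrite ip_frame_kernel; last exact: Cintegrable_C.
  rewrite -(orthoproj_frame Sl sf); last exact: Cintegrable_C.
  by rewrite kS //; exact: square_integrable_C.
move=> dk; suff d0 : d = 0.
  have : d y = 0 by rewrite d0.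
  by rewrite /d Csphere_evalB => /eqP; rewrite subr_eq0 => /eqP.
apply: (ip_eq0 sigma_inv).
rewrite {2}/d addrC -scaleN1r ip_linr; last exact: Cintegrable_C.
by rewrite conjc_opp conjc_one dk mulN1r addNr.
Qed.

Lemma frame_kernel_mem S s x : lin_closed S -> parseval_frame S s ->
  S (frame_kernel s x).
Proof. by move=> Sl [sS _]; exact: (lin_closed_sum (fun e => (e x)^*)). Qed.

(** As functions of y, both sides lie in S and represent evaluation at x on S, and such a
    representer is unique. *)
Lemma frame_kernel_rot S s U x y : lin_closed S -> parseval_frame S s ->
  unitary_invariant S ->
  frame_kernel s (rot U x) (rot U y) = frame_kernel s x y.
Proof.
move=> Sl sf Si; pose k := comp_rot (frame_kernel s (rot U x)) U.
have Sk : S k by apply: Si; exact: frame_kernel_mem sf.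
have rep f : S f -> ip f k = ip f (frame_kernel s x).
  move=> Sf; pose V := unitary_inv U.
  rewrite -(ip_rot sigma_inv f k V).
  have -> : comp_rot k V = frame_kernel s (rot U x).
    by apply: CsphereP => z; rewrite /k /comp_rot /= rotVK.
  rewrite !ip_frame_kernel; try exact: Cintegrable_C.
  have <- := sf.2 _ (Si _ V Sf); have <- := sf.2 _ Sf.
  by rewrite /comp_rot /= rotK.
pose d := k - frame_kernel s x.
have Sd : S d.
  by rewrite /d addrC -scaleN1r; apply: Sl.2 => //; exact: frame_kernel_mem sf.
have : d = 0.
  apply: (ip_eq0 sigma_inv); rewrite {2}/d addrC -scaleN1r ip_linr;
    last exact: Cintegrable_C.
  by rewrite conjc_opp conjc_one (rep d Sd) mulN1r addNr.
move=> d0; have : d y = 0 by rewrite d0.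
by rewrite /d Csphere_evalB => /eqP; rewrite subr_eq0 => /eqP.
Qed.

Lemma frame_kernel_norm_const S s x x' : lin_closed S -> parseval_frame S s ->
  unitary_invariant S ->
  \int[sigma]_y normc (frame_kernel s x y) = \int[sigma]_y normc (frame_kernel
    s x' y).
Proof.
move=> Sl sf Si; have [U <-] := unitary_transitive x x'.
rewrite -[RHS](Rintegral_rot sigma_inv U); last exact: normc_C_cts.
by apply: eq_Rintegral => y _; rewrite (frame_kernel_rot _ _ _ Sl sf Si).
Qed.

Lemma fproj_bound s c f :
  (forall x, \int[sigma]_y normc (frame_kernel s x y) = c) ->
  supnorm (fproj s f) <= c * supnorm f.
Proof.
move=> kc; apply: supnorm_le => x.
rewrite -(ip_frame_kernel s x (Cintegrable_C sigma f)) -(kc x).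
have ki := continuous_integrable sigma (@normc_C_cts R m (frame_kernel s x)).
rewrite mulrC -RintegralZl //.
have f0 : 0 <= supnorm f by apply: le_trans (normc_ge0 _) (normc_le_supnorm f
  x).
pose u := (supnorm f)%:C *: frame_kernel s x.
have uE y : supnorm f * normc (frame_kernel s x y) = normc (u y).
  by rewrite Csphere_evalZ normcM normc_real ger0_norm.
under eq_Rintegral do rewrite uE.
apply: normc_Cintegral_le.
- exact: (@Cintegrable_mul _ _ sigma f (Cconj (frame_kernel s x))
    (Cintegrable_C _ _)).
- exact: (continuous_integrable sigma (@normc_C_cts R m u)).
move=> y; rewrite -uE normcM normc_conjc.
by apply: ler_wpM2r; rewrite ?normc_ge0 ?normc_le_supnorm.
Qed.

End Frames.

(** * Operator norms and the complex Hahn-Banach theorem *)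

Section ComplexHahnBanach.
Context (R : realType).

(** An alias of Y for restriction of scalars: the real module structure lives here, apart from the
    complex one of Y. *)
Definition real_scalars (Y : lmodType R[i]) : Type := Y.

HB.instance Definition _ (Y : lmodType R[i]) :=
  GRing.Zmodule.copy (real_scalars Y) Y.

Section RealScalars.
Variable Y : lmodType R[i].

Definition real_scale (r : R) (y : real_scalars Y) : real_scalars Y :=
  r%:C *: (y : Y).

Lemma real_scaleA r s y : real_scale r (real_scale s y) = real_scale (r * s) y.
Proof. by rewrite /real_scale scalerA -rmorphM. Qed.

Lemma real_scale1 : left_id 1 real_scale.
Proof. by move=> y; rewrite /real_scale rmorph1 scale1r. Qed.

Lemma real_scaleDr : right_distributive real_scale +%R.
Proof. by move=> r y z; rewrite /real_scale scalerDr. Qed.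

Lemma real_scaleDl y : {morph real_scale^~ y : r s / r + s}.
Proof. by move=> r s; rewrite /real_scale rmorphD scalerDl. Qed.

HB.instance Definition _ := GRing.Zmodule_isLmodule.Build R (real_scalars Y)
  real_scaleA real_scale1 real_scaleDr real_scaleDl.

End RealScalars.

Section Norms.
Variable V : normedModType R[i].

Lemma rnormE (x : V) : `|x| = (rnorm x)%:C.
Proof. by rewrite /rnorm RRe_real // normr_real. Qed.

Lemma rnorm_ge0 (x : V) : 0 <= rnorm x.
Proof. by rewrite -lecR -rnormE normr_ge0. Qed.

Lemma rnormD (x y : V) : rnorm (x + y) <= rnorm x + rnorm y.
Proof. by rewrite -lecR rmorphD /= -!rnormE ler_normD. Qed.

Lemma rnormZ (a : R[i]) (x : V) : rnorm (a *: x) = normc a * rnorm x.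
Proof. by apply: complexI; rewrite rmorphM /= -!rnormE normrZ normr_normc. Qed.

Lemma rnorm0 : rnorm (0 : V) = 0.
Proof. by rewrite /rnorm normr0. Qed.

Lemma rnorm_sum (I : Type) (r : seq I) (F : I -> V) :
  rnorm (\sum_(i <- r) F i) <= \sum_(i <- r) rnorm (F i).
Proof.
elim: r => [|i r IH]; first by rewrite !big_nil rnorm0.
by rewrite !big_cons; apply: le_trans (rnormD _ _) _; rewrite lerD2l.
Qed.

End Norms.

Section OperatorNorm.
Variables V W : normedModType R[i].

Lemma op_norm_le (Q : V -> W) (c : R) :
  (forall x, rnorm (Q x) <= c * rnorm x) -> 0 <= c -> (op_norm Q <= c%:E)%E.
Proof.
move=> Qc c0; apply: ge_ereal_sup => _ [x /= x1 <-]; rewrite lee_fin.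
by apply: le_trans (Qc x) _; rewrite -[leRHS]mulr1 ler_wpM2l.
Qed.

Lemma linear_scale (Q : V -> W) : linear Q -> forall a x, Q (a *: x) = a *: Q x.
Proof.
move=> Ql; have Q0 : Q 0 = 0.
  have := Ql (-1) 0 0; rewrite scaleN1r oppr0 addr0 => e.
  by rewrite {1}e scaleN1r addNr.
by move=> a x; rewrite -[a *: x]addr0 Ql Q0 addr0.
Qed.

Lemma linear_lin_comb (Q : V -> W) (I : Type) (r : seq I) (d : I ->
  R[i]) (e : I -> V) :
  linear Q -> Q (\sum_(i <- r) d i *: e i) = \sum_(i <- r) d i *: Q (e i).
Proof.
move=> Ql; elim: r => [|i r IH]; last by rewrite !big_cons Ql IH.
rewrite !big_nil; have := linear_scale Ql 0 0.
by rewrite !scale0r.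
Qed.

(** Dividing x by its norm turns the supremum over the unit ball into a homogeneous bound. *)
Lemma op_norm_bounded (Q : V -> W) : linear Q -> (op_norm Q < +oo)%E ->
  exists2 N : R, op_norm Q = N%:E & forall x, rnorm (Q x) <= N * rnorm x.
Proof.
move=> Ql Qoo; have QZ := linear_scale Ql.
have ub x : rnorm x <= 1 -> ((rnorm (Q x))%:E <= op_norm Q)%E.
  by move=> x1; apply: ereal_sup_ubound; exists x.
have Q0 : (0%:E <= op_norm Q)%E.
  by apply: le_trans (ub 0 _); rewrite ?lee_fin ?rnorm_ge0 // rnorm0.
case E : (op_norm Q) Qoo Q0 ub => [N| |] // _ _ ub.
exists N => // x; have [x0|x0] := eqVneq (rnorm x) 0.
  have -> : x = 0 by apply/eqP; rewrite -normr_eq0 rnormE x0.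
  by rewrite -(scale0r (0 : V)) QZ !scale0r !rnorm0 mulr0.
have xp : 0 < rnorm x by rewrite lt_neqAle eq_sym x0 rnorm_ge0.
have nx : normc ((rnorm x)^-1)%:C = (rnorm x)^-1.
  by rewrite normc_real ger0_norm // invr_ge0 ltW.
have := ub (((rnorm x)^-1)%:C *: x).
rewrite QZ !rnormZ nx mulVf // lexx lee_fin => /(_ isT).
by rewrite mulrC ler_pdivrMr.
Qed.

End OperatorNorm.

(** The real part of [l] is extended first and the complex functional is recovered from it. The
    graph of the pairs (I f, Re (l f)) describes the functional on I(S) without inverting I. *)
Theorem hahn_banach_extension (V : lmodType R[i])
    (Y : normedModType R[i]) (S : set V) (I : V -> Y) (l : V -> R[i]) (M : R) :
  S 0 -> (forall a f g, S f -> S g -> S (a *: f + g)) ->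
  (forall a f g, S f -> S g -> I (a *: f + g) = a *: I f + I g) ->
  (forall a f g, S f -> S g -> l (a *: f + g) = a * l f + l g) ->
  0 <= M -> (forall f, S f -> normc (l f) <= M * rnorm (I f)) ->
  exists psi : Y -> R[i],
    [/\ forall a y z, psi (a *: y + z) = a * psi y + psi z,
        forall y, normc (psi y) <= M * rnorm y &
        forall f, S f -> psi (I f) = l f].
Proof.
move=> S0 Sl Il ll M0 lM.
have I0 : I 0 = 0.
  have := Il (-1) 0 0 S0 S0; rewrite scaleN1r oppr0 addr0 => e.
  by rewrite {1}e scaleN1r addNr.
have l0 : l 0 = 0.
  have := ll (-1) 0 0 S0 S0; rewrite scaleN1r oppr0 addr0 => e.
  by rewrite {1}e mulN1r addNr.
pose q (y : real_scalars Y) := M * rnorm (y : Y).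
pose G0 : set (real_scalars Y * R) := [set u | exists2 f, S f & u = (I f,
  complex.Re (l f))].
have [||||| U [Ul Uq UG]] := @hahn_banach_graph R (real_scalars Y) q G0.
- by move=> u v; rewrite /q -mulrDr ler_wpM2l // rnormD.
- move=> r u r0; rewrite /q [rnorm _](_ : _ = r * rnorm (u : Y)) 1?mulrCA //.
  by rewrite -[in RHS](ger0_norm r0) -normc_real -rnormZ.
- by exists 0 => //; rewrite I0 l0.
- move=> r _ _ [f Sf ->] [g Sg ->]; exists (r%:C *: f + g); first exact: Sl.
  by rewrite /= Il // ll // -ReM_real; case: (_ * l f) (l g) => [? ?] [? ?].
- move=> _ [f Sf ->] /=; rewrite /q; apply: le_trans (lM f Sf).
  by apply: le_trans (ler_norm _) (normr_Re_le _).
have {Ul}Ul r (y z : Y) : U (r%:C *: y + z) = r * U y + U z by exact: Ul.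
have UD (y z : Y) : U (y + z) = U y + U z.
  by have := Ul 1 y z; rewrite rmorph1 scale1r mul1r.
have U0 : U (0 : Y) = 0 by have := UD 0 0; rewrite addr0 => /eqP;
  rewrite -subr_eq0 opprD addNKr oppr_eq0 => /eqP.
have UZ r (y : Y) : U (r%:C *: y) = r * U y.
  by have := Ul r y 0; rewrite !addr0 U0 addr0.
(* The complex-linear functional with real part U. *)
pose psi (y : Y) : R[i] := U y +i* (- U ('i *: y)).
have psiD y z : psi (y + z) = psi y + psi z.
  by apply/eqP; rewrite eq_complex /= scalerDr !UD opprD !eqxx.
have psiZ a y : psi (a *: y) = a * psi y.
  have ii (z : Y) : 'i *: ('i *: z) = - z.
    rewrite scalerA -[RHS]scaleN1r; congr (_ *: z).
    by apply/eqP; rewrite eq_complex /= !(mulr0, mul0r, mulr1, addr0, sub0r,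
      oppr0) !eqxx.
  have aE (z : Y) : a *: z = (complex.Re a)%:C *: z + (complex.Im a)%:C *: ('i
    *: z).
    by rewrite {1}[a]complexE scalerDl [_ * (_%:C)]mulrC -scalerA.
  have UN (z : Y) : U (- z) = - U z.
    by have := UZ (-1) z; rewrite rmorphN1 scaleN1r mulN1r.
  have Ua (z : Y) : U (a *: z) = complex.Re a * U z + complex.Im a * U ('i *:
    z).
    by rewrite aE UD !UZ.
  have ia : 'i *: (a *: y) = a *: ('i *: y) by rewrite !scalerA mulrC.
  rewrite /psi ia !Ua ii UN; case: (a) => c d /=; apply/eqP;
    rewrite eq_complex /=.
  by apply/andP; split; apply/eqP; ring.
exists psi; split => [a y z|y|f Sf].
- by rewrite psiD psiZ.
- have [z0|z0] := eqVneq (psi y) 0.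
    by rewrite z0 normc0 mulr_ge0 ?rnorm_ge0.
  have nz : 0 < normc (psi y).
    by rewrite lt_neqAle normc_ge0 andbT eq_sym;
      apply: contra_neq z0 => /eq0_normc.
  (* Rotating y by the unimodular [c] makes psi real and nonnegative there, so the bound on U alone
     controls the modulus. *)
  pose c := ((normc (psi y))^-1)%:C * (psi y)^*.
  have cz : c * psi y = (normc (psi y))%:C.
    rewrite /c -mulrA [_ * psi y]mulrC mulc_conj -rmorphM /= expr2 mulrA mulVf
      ?mul1r //.
    by rewrite gt_eqF.
  have nc : normc c = 1.
    by rewrite /c normcM normc_real normc_conjc ger0_norm ?invr_ge0 ?normc_ge0
      // mulVf ?gt_eqF.
  have -> : normc (psi y) = U (c *: y).
    by have := congr1 (@complex.Re R) (psiZ c y); rewrite cz.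
  by apply: le_trans (Uq _) _; rewrite /q rnormZ nc mul1r.
have Re_eq g : S g -> U (I g) = complex.Re (l g).
  by move=> Sg; apply: (UG (I g, complex.Re (l g))); exists g.
have Sif : S ('i *: f) by rewrite -[_ *: f]addr0; exact: Sl.
rewrite /psi Re_eq //.
have -> : 'i *: I f = I ('i *: f).
  by have := Il 'i f 0 Sf S0; rewrite !addr0 I0 addr0.
rewrite Re_eq //.
have -> : l ('i *: f) = 'i * l f.
  by have := ll 'i f 0 Sf S0; rewrite !addr0 l0 addr0.
by case: (l f) => c d /=; rewrite mul0r mul1r sub0r opprK.
Qed.

End ComplexHahnBanach.

(** * The trace bound *)

(** The classical iteration p + (t - p^2) / 2 for the square root of t, divided by t: the values
    approximate the inverse square root. It is stated over any field because it is applied both to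
    complex kernels and to real numbers. *)
Fixpoint sqrt_poly (F : fieldType) (n : nat) (t : F) : F :=
  if n is k.+1 then
    let r := sqrt_poly k t in r + (1 - t * r ^+ 2) / 2
  else 0.

(* t * sqrt_poly n t increases to the square root of t on [0, 1]. *)
Lemma sqrt_poly_bounds (F : realFieldType) (n : nat) (u : F) : 0 <= u <= 1 ->
  [/\ 0 <= sqrt_poly n (u ^+ 2), u * sqrt_poly n (u ^+ 2) <= 1 &
      (1 - u * sqrt_poly n (u ^+ 2)) * (2 + n%:R * u) <= 2].
Proof.
move=> /andP[u0 u1]; elim: n => [|n [r0 r1 rn]] /=.
  by rewrite mulr0 subr0 mul0r addr0 mul1r; split.
set r := sqrt_poly n _ in r0 r1 rn *.
set p := u * r in r1 rn *.
have p0 : 0 <= p by exact: mulr_ge0.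
have -> : u ^+ 2 * r ^+ 2 = p ^+ 2 by rewrite /p exprMn.
have p2 : p ^+ 2 <= 1 by rewrite expr_le1.
rewrite mulrDr -/p; have n0 : (0 : F) <= n%:R by exact: ler0n.
have E0 : 0 <= 1 - p by lra.
split; first by apply: addr_ge0 => //; apply: divr_ge0 => //; lra.
(* As u <= 1, the new value is at most p + (1 - p^2) / 2 = 1 - (1 - p)^2 / 2. *)
- have : u * ((1 - p ^+ 2) / 2) <= (1 - p ^+ 2) / 2.
    by rewrite ler_piMl // divr_ge0 //; lra.
  have := sqr_ge0 (1 - p); rewrite sqrrB expr1n; lra.
set q := u * _.
(* The error is multiplied by 1 - u (1 + p) / 2, which is at most 1 - u / 2. *)
have qE : 1 - (p + q) <= (1 - p) * (1 - u / 2).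
  have -> : q = (1 - p) * (1 + p) * u / 2 by rewrite /q; field.
  have : 0 <= (1 - p) * p * u by rewrite !mulr_ge0.
  lra.
have -> : n.+1%:R * u = n%:R * u + u.
  by rewrite -[n.+1]addn1 natrD mulrDl mul1r.
(* The induction closes because (1 - u / 2) (2 + (n + 1) u) <= 2 + n u. *)
apply: (@le_trans _ _ ((1 - p) * (1 - u / 2) * (2 + (n%:R * u + u)))).
  by apply: ler_wpM2r => //; rewrite !addr_ge0 // mulr_ge0.
apply: le_trans rn; rewrite -mulrA; apply: ler_wpM2l => //.
have : 0 <= n%:R * u * u by rewrite !mulr_ge0.
have := sqr_ge0 u; rewrite expr2; lra.
Qed.

Lemma sqrt_poly_real (R : realType) (n : nat) (t : R) :
  sqrt_poly n (t%:C : R[i]) = (sqrt_poly n t)%:C.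
Proof.
elim: n => [|n IH] //=; rewrite IH.
by rewrite rmorphD /= fmorph_div /= rmorphB /= rmorphM /= rmorphXn /= rmorph1
  rmorph_nat.
Qed.

Section TraceBound.
Context (R : realType) (m : nat).
Variable sigma : probability (borel_csphere R m) R.
Hypothesis sigma_inv : rotation_invariant sigma.
Notation T := (csphere R m).
Notation C := (Csphere R m).
Implicit Types (a b : R[i]) (f g h : C) (U : unitary_group R m).
Notation L := (Cintegral sigma).
Notation ip := (L2inner sigma).
Variables (S : set C) (s : seq C) (c : R).
Hypotheses (Sl : lin_closed S) (sf : parseval_frame sigma S s).
Hypothesis accS : accessible sigma S.
Hypothesis kc : forall x, \int[sigma]_y normc (frame_kernel s x y) = c.

Let Si : unitary_invariant S. Proof. by case: accS. Qed.

Lemma sep_kernel_bounded (v : seq (C * C)) :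
  exists2 M : R, 0 < M & forall x y, normc (sep_kernel v x y) <= M.
Proof.
elim: v => [|p v [M M0 vM]].
  by exists 1 => // x y; rewrite /sep_kernel big_nil normc0.
have pp : 0 <= supnorm p.1 * supnorm p.2.
  exact: le_trans (normc_ge0 _) (normc_ip_le sigma p.1 p.2).
exists (supnorm p.1 * supnorm p.2 + M) => [|x y]; first by rewrite ltr_wpDl.
rewrite /sep_kernel big_cons; apply: le_trans (le_normcD _ _) (lerD _ (vM x y)).
by rewrite normcM ler_pM ?normc_ge0 ?normc_le_supnorm.
Qed.

Lemma separable_sqrt_poly n (t : T -> T -> R[i]) : separable t ->
  separable (fun x y => sqrt_poly n (t x y)).
Proof.
move=> ts; elim: n => [|n IH] /=; first exact: separable_cst.
apply: separableD => //.
have E := separableM ts (separableM IH IH).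
apply: (separable_ext _ (separableM (separableD (separable_cst m 1)
  (separableM (separable_cst m (-1)) E)) (separable_cst m (2^-1)))) => x y.
by rewrite expr2 mulN1r.
Qed.

(* A separable substitute for the kernel conj k / |k|. *)
Lemma frame_kernel_sign (eps : R) : 0 < eps ->
  exists v : seq (C * C),
  [/\ forall U x y, sep_kernel v (rot U x) (rot U y) = sep_kernel v x y,
      forall x y, (sep_kernel v y x)^* = sep_kernel v x y,
      forall x y, normc (sep_kernel v x y) <= 1 &
      forall x y, normc (frame_kernel s x y) - eps <=
        complex.Re (sep_kernel v x y * frame_kernel s x y)].
Proof.
move=> e0; pose w x y := frame_kernel s x y.
have ws : separable w.
  apply: (@separable_ext R m w (fun x y => \sum_(e <- s) Cconj e x * e y)).
    by move=> x y; rewrite /w Csphere_eval_sum.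
  by apply: separable_sum => e; exact: separable_pair.
have [M M0 wM] : exists2 M : R, 0 < M & forall x y, normc (w x y) <= M.
  by case: (ws) => q ->; exact: sep_kernel_bounded.
(* The bound on the iteration gives u (1 - u r) <= 2 / n; rescaled by M, the error is at most 2 M /
   n, hence at most [eps]. *)
have [n n_gt0 nE] : exists2 n, (0 < n)%N & 2 * M <= n%:R * eps.
  exists (Num.bound (2 * M / eps)).+1 => //.
  rewrite -ler_pdivrMr //; apply/ltW/(lt_le_trans (archi_boundP _)).
    by rewrite divr_ge0 ?mulr_ge0 // ltW.
  by rewrite ler_nat.
(* With t = |k|^2 / M^2 in [0, 1], [sqrt_poly n t] approximates M / |k|, so v approximates conj k /
   |k|. *)
pose t x y := w x y * (w x y)^* * (M^-1 ^+ 2)%:C.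
pose v x y := (w x y)^* * (M^-1)%:C * sqrt_poly n (t x y).
have vs : separable v.
  apply: separableM; last apply: separable_sqrt_poly.
    by apply: separableM (separable_cst m _); exact: separable_conj.
  apply: separableM (separable_cst m _); apply: separableM => //.
  exact: separable_conj.
pose u x y := normc (w x y) / M.
have tE x y : t x y = (u x y ^+ 2)%:C.
  by rewrite /t mulc_conj -rmorphM /= /u expr_div_n exprVn.
have u01 x y : 0 <= u x y <= 1.
  by rewrite /u divr_ge0 ?normc_ge0 ?(ltW M0) //= ler_pdivrMr // mul1r.
have wU U x y : w (rot U x) (rot U y) = w x y.
  exact: (frame_kernel_rot sigma_inv U x y Sl sf Si).
have wJ x y : (w y x)^* = w x y.
  by rewrite /w (frame_kernel_sym s x y) conjc_conj.
case: (vs) => q vq; exists q; rewrite -vq; split.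
- by move=> U x y; rewrite /v /t wU.
- move=> x y; have Mr : (M^-1)%:C^* = (M^-1)%:C by exact: conjc_real.
  have sr : (sqrt_poly n (t y x))^* = sqrt_poly n (t x y).
    rewrite [t x y](_ : _ = t y x); last first.
      by rewrite /t -(wJ x y) conjc_conj [X in X * _]mulrC.
    by rewrite tE sqrt_poly_real; exact: conjc_real.
  by rewrite /v !conjc_mul sr Mr wJ.
- move=> x y; rewrite /v tE sqrt_poly_real !normcM normc_conjc !normc_real.
  have [r0 r1 _] := sqrt_poly_bounds n (u01 x y).
  by rewrite (ger0_norm r0) ger0_norm ?invr_ge0 ?(ltW M0).
move=> x y; have [r0 r1 rn] := sqrt_poly_bounds n (u01 x y).
have -> : v x y * w x y = (M * (u x y ^+ 2 * sqrt_poly n (u x y ^+ 2)))%:C.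
  rewrite /v tE sqrt_poly_real mulrAC -!mulrA [w x y * _]mulrC mulrA.
  rewrite [(w x y)^* * _]mulrC.
  transitivity (w x y * (w x y)^* * (M^-1)%:C * (sqrt_poly n (u x y ^+ 2))%:C);
    first by ring.
  rewrite mulc_conj -!rmorphM /= /u expr_div_n; congr (_%:C).
  by field; rewrite gt_eqF.
rewrite Re_real -/(w x y) (_ : normc (w x y) = M * u x y); last first.
  by rewrite /u mulrC divfK // gt_eqF.
set r := sqrt_poly n _ in r0 r1 rn *; set z := u x y in r0 r1 rn *.
have n0 : 0 < n%:R :> R by rewrite ltr0n.
rewrite -(ler_pM2l n0) mulrBr.
have : M * (n%:R * z * (1 - z * r)) <= M * 2 by rewrite ler_pM2l //; lra.
lra.
Qed.

Lemma orthoprojCE f : orthoprojC sigma S f = fproj sigma s f.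
Proof. exact: (orthoproj_frame sigma_inv Sl sf (Cintegrable_C sigma f)). Qed.

Lemma fproj_mem f : S (fproj sigma s f).
Proof. by apply: lin_closed_sum Sl _; case: sf. Qed.

(** Accessibility includes that the orthogonal projection itself commutes with rotations. *)
Lemma fproj_rot f U :
  fproj sigma s (comp_rot f U) = comp_rot (fproj sigma s f) U.
Proof.
have [_ [[_ Oc] _]] := accS.
by rewrite -!orthoprojCE.
Qed.

Lemma kernel_op_le v f : (forall x y, normc (sep_kernel v x y) <= 1) ->
  supnorm (kernel_op sigma v f) <= supnorm f.
Proof.
move=> v1; apply: supnorm_le => x; rewrite kernel_opE.
pose k : C := mkcts (@sep_kernel_cts R m v x).
have ci : sigma.-integrable [set: borel_csphere R m] (EFin \o (fun=> supnorm
  f)).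
  by apply: continuous_integrable => z; exact: cst_continuous.
apply: le_trans (normc_Cintegral_le (Cintegrable_C sigma (Cmul f k)) ci _) _.
  move=> y; rewrite normcM -[leRHS]mulr1.
  by apply: ler_pM; rewrite ?normc_ge0 ?normc_le_supnorm //; exact: v1.
by rewrite Rintegral_cst // [X in fine X]probability_setT mulr1.
Qed.

(* Otherwise pi + pi V (1 - pi) would be a second projection onto S commuting
   with rotations. *)
Lemma kernel_op_stable v :
  (forall U x y, sep_kernel v (rot U x) (rot U y) = sep_kernel v x y) ->
  (forall x y, (sep_kernel v y x)^* = sep_kernel v x y) ->
  (forall x y, normc (sep_kernel v x y) <= 1) ->
  forall h, S h -> S (kernel_op sigma v h).
Proof.
move=> vU vJ v1 h Sh; pose V := kernel_op sigma v.
pose pi f := fproj sigma s f.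
pose Q f := pi f + pi (V (f - pi f)).
have piD a f g : pi (a *: f + g) = a *: pi f + pi g by exact: fproj_linear.
have VD a f g : V (a *: f + g) = a *: V f + V g by exact: kernel_op_linear.
have piS f : S f -> pi f = f by move=> Sf; rewrite /pi -(sf.2 f Sf).
have pi0 : pi 0 = 0 by have := linear_scale piD 0 0; rewrite !scale0r.
have V0 : V 0 = 0 by have := linear_scale VD 0 0; rewrite !scale0r.
have Ql : linear Q.
  move=> a f g; have -> : Q (a *: f + g) = pi (a *: f + g) +
      pi (V (a *: (f - pi f) + (g - pi g))).
    rewrite /Q; congr (_ + pi (V _)); rewrite piD scalerBr opprD.
    by rewrite addrACA.
  by rewrite VD !piD /Q scalerDr addrACA.
have c0 : 0 <= c.
  by rewrite -(kc (e1 R m)); apply: Rintegral_ge0 => x _; exact: normc_ge0.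
have pib f : supnorm (pi f) <= c * supnorm f by exact: fproj_bound.
(* The norms of pi, V and 1 - pi are at most c, 1 and 1 + c. *)
have Qb f : rnorm (Q f) <= (c + c * (1 + c)) * rnorm f.
  apply: le_trans (rnormD _ _) _; rewrite mulrDl; apply: lerD; first exact: pib.
  apply: le_trans (pib _) _; rewrite -mulrA; apply: ler_wpM2l => //.
  apply: le_trans (kernel_op_le _ v1) _.
  have := rnormD f (- pi f); rewrite [rnorm (- _)](_ : _ = rnorm (pi f));
    last first.
    by rewrite /rnorm normrN.
  move=> H; apply: le_trans H _; rewrite mulrDl mul1r lerD2l; exact: pib.
have [_ [_ uniqP]] := accS.
have QE : orthoprojC sigma S = Q.
  apply: uniqP; split; last first.
    move=> f U; rewrite /Q /pi fproj_rot.
    have -> : comp_rot f U - comp_rot (fproj sigma s f) U =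
      comp_rot (f - fproj sigma s f) U by apply: CsphereP.
    by rewrite [V _](kernel_op_rot sigma_inv) // fproj_rot; apply: CsphereP.
  split=> //.
  - apply: le_lt_trans (op_norm_le Qb _) (ltry _).
    by rewrite addr_ge0 // mulr_ge0 // addr_ge0.
  - move=> f; rewrite /Q -[pi f]scale1r; apply: Sl.2; exact: fproj_mem.
  - by move=> f Sf; rewrite /Q piS // subrr V0 pi0 addr0.
have piV f : pi (V (f - pi f)) = 0.
  have := congr1 (fun q => q f) QE; rewrite orthoprojCE /Q -/(pi f) => /eqP.
  by rewrite -subr_eq0 opprD addNKr oppr_eq0 => /eqP.
(* Since V is self-adjoint and g lies in S, the pairing of f - pi f with V g equals that of pi V (f
   - pi f) = 0 with g. *)
have orth f g : S g -> ip (f - pi f) (V g) = 0.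
  move=> Sg; rewrite -(kernel_op_adjoint sigma (f - pi f) g vJ) -/V.
  rewrite -(ip_fproj sf Sg (Cintegrable_C _ _)) -/(pi _) piV.
  by have := @ip_suml R m sigma C [::] (fun=> 0) id g; rewrite !big_nil.
(* For f = V h, the difference f - pi f is orthogonal to f by [orth] and to pi f by projection,
   hence to itself. *)
pose f := V h; suff fE : f = pi f.
  by change (S f); rewrite fE; exact: fproj_mem.
apply/eqP; rewrite -subr_eq0; apply/eqP; apply: (ip_eq0 sigma_inv).
have := ip_linr (-1) (pi f) f (Cintegrable_C sigma (f - pi f)).
rewrite (orth f h Sh : ip (f - pi f) f = 0).
rewrite (ip_sub_fproj sf (fproj_mem f) (Cintegrable_C sigma f)) mulr0 addr0.
by rewrite scaleN1r addrC.
Qed.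

(* The trace of V on S is also the trace of P V: the former is the integral of
   v k, close to c, the latter is at most the norm of P since |v| <= 1. *)
Lemma trace_bound (P : C -> C) : bounded_projection S P ->
  (c%:E <= op_norm P)%E.
Proof.
move=> [Pl Poo PS PI]; have [N -> PN] := op_norm_bounded Pl Poo.
rewrite lee_fin; apply/ler_addgt0Pr => eps e0.
have [v [vU vJ v1 vw]] := frame_kernel_sign e0.
pose V := kernel_op sigma v.
have VS h : S h -> S (V h) by exact: kernel_op_stable.
(* The trace of V on S, read off from the Parseval frame. *)
pose tr := \sum_(e <- s) ip (V e) e.
have trE1 : tr = L (fun x => L (fun y =>
  sep_kernel v x y * frame_kernel s x y)).
  transitivity (L (\sum_(e <- s) 1 *: (Cmul (V e) (Cconj e)))).
    by rewrite Cintegral_sum; apply: eq_bigr => e _; rewrite mul1r.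
  congr Cintegral; apply/funext => x; rewrite Csphere_eval_sum.
  pose k : C := mkcts (@sep_kernel_cts R m v x).
  transitivity (L (\sum_(e <- s) (e x)^* *: (Cmul e k))).
    rewrite Cintegral_sum; apply: eq_bigr => e _.
    by rewrite scale1r [LHS]mulrC; congr (_ * _); exact: kernel_opE.
  congr Cintegral; apply/funext => y; rewrite !Csphere_eval_sum big_distrr.
  apply: eq_bigr => e _; rewrite !Csphere_evalZ.
  by rewrite (_ : Cmul e k y = e y * sep_kernel v x y) // mulrA mulrC.
have trE2 : tr = L (fun y => \sum_(p <- v) P p.1 y * p.2 y).
  transitivity (\sum_(e <- s) \sum_(p <- v) L (Cmul e p.2) * ip (P p.1) e).
    rewrite /tr big_seq [RHS]big_seq; apply: eq_bigr => e es.
    (* Stability of S under V enters here: V e lies in S, so P fixes it. *)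
    rewrite -(PI (V e)); last by apply: VS; exact: sf.1.
    by rewrite /V /kernel_op (linear_lin_comb _ _ _ Pl) ip_suml.
  rewrite exchange_big /=.
  transitivity (L (\sum_(p <- v) 1 *: Cmul (P p.1) p.2)).
    rewrite Cintegral_sum; apply: eq_bigr => p _; rewrite mul1r.
    transitivity (L (\sum_(e <- s) ip (P p.1) e *: Cmul e p.2)).
      by rewrite Cintegral_sum; apply: eq_bigr => e _; rewrite mulrC.
    congr Cintegral; apply/funext => y; rewrite Csphere_eval_sum.
    have -> : Cmul (P p.1) p.2 y = fproj sigma s (P p.1) y * p.2 y.
      by rewrite -(sf.2 _ (PS p.1)).
    rewrite Csphere_eval_sum big_distrl; apply: eq_bigr => e _.
    by rewrite !Csphere_evalZ /= mulrA.
  congr Cintegral; apply/funext => y; rewrite Csphere_eval_sum.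
  by apply: eq_bigr => p _; rewrite scale1r.
have trN : normc tr <= N.
  rewrite trE2.
  have N0 : 0 <= N.
    have := PN (Cone R m); have := rnorm_ge0 (P (Cone R m)).
    have : 0 < supnorm (Cone R m).
      apply: lt_le_trans (normc_le_supnorm (Cone R m) (e1 R m)).
      by rewrite [normc _]normc1.
    rewrite -[supnorm _]/(rnorm (Cone R m)) => p0 a0 b0.
    by rewrite -(pmulr_lge0 _ p0); exact: le_trans a0 b0.
  have ci : sigma.-integrable [set: borel_csphere R m] (EFin \o (fun=> N)).
    by apply: continuous_integrable => z; exact: cst_continuous.
  have -> : N = \int[sigma]_x N.
    by rewrite Rintegral_cst // [X in fine X]probability_setT mulr1.
  apply: normc_Cintegral_le => //.
    have -> : (fun y => \sum_(p <- v) P p.1 y * p.2 y) =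
        \sum_(p <- v) Cmul (P p.1) p.2.
      by apply/funext => y; rewrite Csphere_eval_sum.
    exact: Cintegrable_C.
  (* For fixed y the integrand is P applied to v(., y) and evaluated at y; that function has norm at
     most 1. *)
  move=> y; pose k : C := \sum_(p <- v) p.2 y *: p.1.
  have -> : \sum_(p <- v) P p.1 y * p.2 y = P k y.
    by rewrite (linear_lin_comb _ _ _ Pl) Csphere_eval_sum;
      apply: eq_bigr => p _; rewrite Csphere_evalZ mulrC.
  apply: le_trans (normc_le_supnorm _ _) _; apply: le_trans (PN k) _.
  rewrite -[leRHS]mulr1; apply: ler_wpM2l => //; apply: supnorm_le => x.
  suff -> : k x = sep_kernel v x y by exact: v1.
  by rewrite Csphere_eval_sum; apply: eq_bigr => p _;
    rewrite Csphere_evalZ mulrC.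
have trc : c - eps <= complex.Re tr.
  rewrite trE1 Re_Cintegral.
  (* Separability of the integrand makes the inner integral continuous in x, hence integrable. *)
  have [q qE] : separable (fun x y => sep_kernel v x y * frame_kernel s x y).
    apply: separableM; first by exists v.
    apply: (@separable_ext R m _ (fun x y => \sum_(e <- s) Cconj e x * e y)).
      by move=> x y; rewrite Csphere_eval_sum.
    by apply: separable_sum => e; exact: separable_pair.
  have qxy x y : sep_kernel v x y * frame_kernel s x y = sep_kernel q x y by
    rewrite -qE.
  have cst_i (r : R) : sigma.-integrable [set: borel_csphere R m] (EFin \o
    (fun=> r)).
    by apply: continuous_integrable => z; exact: cst_continuous.
  have cst_I (r : R) : \int[sigma]_x r = r.
    by rewrite Rintegral_cst // [X in fine X]probability_setT mulr1.
  rewrite -[leLHS]cst_I; apply: le_Rintegral => //.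
    pose k : C := \sum_(p <- q) L p.2 *: p.1.
    have -> : (fun x => complex.Re (L (fun y =>
      sep_kernel v x y * frame_kernel s x y))) =
        (fun x => complex.Re (k x)).
      apply/funext => x; congr (complex.Re _).
      transitivity (L (\sum_(p <- q) p.1 x *: p.2)).
        by congr Cintegral; apply/funext => y; rewrite qxy Csphere_eval_sum.
      rewrite Cintegral_sum Csphere_eval_sum; apply: eq_bigr => p _.
      by rewrite Csphere_evalZ mulrC.
    by case: (Cintegrable_C sigma k).
  move=> x _; rewrite Re_Cintegral -(kc x) -[in leLHS](cst_I eps) -RintegralB
    //; last first.
    exact: (continuous_integrable sigma (@normc_C_cts R m (frame_kernel s x))).
  apply: le_Rintegral => //.
  - have ki := continuous_integrable sigma (@normc_C_cts R m (frame_kernel s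
      x)).
    by apply: eq_integrable (integrableB (@measurableT _ (borel_csphere R m))
      ki (cst_i eps)).
  - under eq_fun do rewrite qxy.
    by case: (continuous_Cintegrable sigma (@sep_kernel_cts R m q x)).
rewrite -lerBlDr; apply: le_trans trc (le_trans (ler_norm _) _).
exact: le_trans (normr_Re_le _) trN.
Qed.

End TraceBound.

(** * The absolute projection constant *)

Section ExtensionBound.
Context (R : realType) (m : nat).
Notation T := (csphere R m).
Notation C := (Csphere R m).
Implicit Types (f g h : C).

(** The weight at x is max(0, eps - D x), where [D] sums the oscillations of all functions of [s],
    so it vanishes unless each of them is within [eps] of its value at x. Compactness leaves
    finitely many weights with positive sum, by which they are divided. *)
Lemma partition_of_unity (s : seq C) (eps : R) : 0 < eps ->
  exists (r : seq T) (phi : T -> T -> R),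
  [/\ forall x, continuous (phi x), forall x z, 0 <= phi x z,
      forall z, \sum_(x <- r) phi x z = 1 &
      forall e x z, e \in s -> phi x z * normc (e z - e x) <= phi x z * eps].
Proof.
move=> e0; pose D x z := \sum_(e <- s) normc (e z - e x).
pose w x z := Num.max 0 (eps - D x z).
have Dc x : continuous (D x).
  apply: (@continuous_sum R T R) => e z.
  exact: (@normc_C_cts R m (e - (cst (e x) : C))).
have wc x : continuous (w x).
  move=> z; apply: (@continuous_max _ _ (fun=> 0) (fun z => eps - D x z)).
    exact: cst_continuous.
  by apply: continuousB; [exact: cst_continuous | exact: Dc].
have w0 x z : 0 <= w x z by rewrite /w le_max lexx.
have wp x : 0 < w x x.
  rewrite /w lt_max; apply/orP; right; rewrite /D big1 ?subr0 // => e _.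
  by rewrite subrr normc0.
have [r rp] := csphere_finite_positive wc w0 wp.
pose W z := \sum_(x <- r) w x z.
have W0 z : W z != 0 by rewrite gt_eqF // rp.
exists r, (fun x z => w x z / W z); split.
- move=> x z; apply: (@continuousM _ _ (w x) (fun z => (W z)^-1));
    first exact: wc.
  by apply: continuousV => //; apply: (@continuous_sum R T R).
- by move=> x z; rewrite divr_ge0 // ltW // rp.
- by move=> z; rewrite -mulr_suml; exact: (divff (W0 z)).
move=> e x z es; have [|wn] := ltP (D x z) eps.
  move=> Dlt; apply: ler_wpM2l; first by rewrite divr_ge0 // ltW // rp.
  apply: le_trans (ltW Dlt);
    rewrite /D (big_rem e) //= lerDl sumr_ge0 // => k _.
  exact: normc_ge0.
have -> : w x z = 0.
  by rewrite /w; apply/max_idPl; rewrite subr_le0; exact: wn.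
by rewrite !mul0r.
Qed.

Variable sigma : probability (borel_csphere R m) R.
Variables (S : set C) (s : seq C) (c : R).
Hypotheses (Sl : lin_closed S) (sf : parseval_frame sigma S s).
Hypothesis c0 : 0 <= c.
Hypothesis piB : forall f, supnorm (fproj sigma s f) <= c * supnorm f.

Let pi f := fproj sigma s f.

(* Hahn-Banach extensions psi x of f |-> f x turn a partition of unity phi into
   a contraction y |-> sum psi_x(y) phi_x of Y into C(K) that almost extends the
   inverse of I; extensions of the coefficient functionals repair the error. *)
Lemma rel_proj_const_le (Y : normedModType R[i]) (I : C -> Y) :
  isometric_embedding S I -> (rel_proj_const (I @` S) <= c%:E)%E.
Proof.
move=> [Il In].
have rI f : S f -> rnorm (I f) = supnorm f by move=> Sf; rewrite /rnorm In.
have ext (l : C -> R[i]) M : 0 <= M ->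
    (forall a f g, l (a *: f + g) = a * l f + l g) ->
    (forall f, normc (l f) <= M * supnorm f) ->
    exists psi : Y -> R[i],
    [/\ forall a y z, psi (a *: y + z) = a * psi y + psi z,
        forall y, normc (psi y) <= M * rnorm y &
        forall f, S f -> psi (I f) = l f].
  move=> M0 ll lM; apply: (hahn_banach_extension Sl.1 Sl.2 Il) => //.
  by move=> f Sf; rewrite rI.
have /choice[psi psiP] (x : T) : exists q : Y -> R[i],
    [/\ forall a y z, q (a *: y + z) = a * q y + q z,
        forall y, normc (q y) <= rnorm y &
        forall f, S f -> q (I f) = f x].
  have [//|//|f|q [q1 q2 q3]] := ext (fun f => f x) 1.
    by rewrite mul1r; exact: normc_le_supnorm.
  by exists q; split=> // y; have := q2 y; rewrite mul1r.
have s0 f : 0 <= supnorm f by exact: (rnorm_ge0 f).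
have /choice[chi chiP] (e : C) : exists q : Y -> R[i],
    [/\ forall a y z, q (a *: y + z) = a * q y + q z,
        forall y, normc (q y) <= supnorm e * rnorm y &
        forall f, S f -> q (I f) = L2inner sigma f e].
  apply: ext => // [a f g|f]; first exact: ip_linl.
  by rewrite mulrC; exact: normc_ip_le.
have Sfp f : S (pi f) by apply: lin_closed_sum Sl _; case: sf.
have I0 : I 0 = 0.
  by have := Il (-1) 0 0 Sl.1 Sl.1; rewrite scaleN1r oppr0 addr0 scaleN1r addNr.
have Isum (J : eqType) (r : seq J) (d : J -> R[i]) (e : J -> C) :
    (forall j, j \in r -> S (e j)) ->
    S (\sum_(j <- r) d j *: e j) /\
    I (\sum_(j <- r) d j *: e j) = \sum_(j <- r) d j *: I (e j).
  elim: r => [|j r IH] re; first by rewrite !big_nil; split=> //; exact: Sl.1.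
  have [|Sr Ir] := IH; first by move=> k kr; apply: re; rewrite inE kr orbT.
  have Sj : S (e j) by apply: re; rewrite mem_head.
  by rewrite !big_cons; split; [exact: Sl.2 | rewrite Il // Ir].
(* The repair term below has norm at most B times [eps]; the choice eta / (B + 1) keeps this below
   [eta] and is defined even when B = 0. *)
pose B : R := \sum_(e <- s) supnorm e * c.
have B0 : 0 <= B by apply: sumr_ge0 => e _; rewrite mulr_ge0.
apply/lee_addgt0Pr => eta eta0; rewrite -EFinD.
pose eps := eta / (B + 1).
have eps0 : 0 < eps by rewrite divr_gt0 // ltr_wpDl.
have [r [phi [phic phi0 phi1 phis]]] := partition_of_unity s eps0.
pose Phi x : C := mkcts (real_complex_cts (phic x)).
pose J (y : Y) : C := \sum_(x <- r) psi x y *: Phi x.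
have JE y z : J y z = \sum_(x <- r) psi x y * (phi x z)%:C.
  by rewrite /J Csphere_eval_sum.
have JD a y z : J (a *: y + z) = a *: J y + J z.
  rewrite /J scaler_sumr -big_split; apply: eq_bigr => x _ /=.
  by have [-> _ _] := psiP x; rewrite scalerDl scalerA.
have nsum (K : Type) (t : seq K) (F : K -> R[i]) :
    normc (\sum_(k <- t) F k) <= \sum_(k <- t) normc (F k).
  elim: t => [|k t IH]; first by rewrite !big_nil normc0.
  by rewrite !big_cons; apply: le_trans (le_normcD _ _) _; rewrite lerD2l.
have JB y : supnorm (J y) <= rnorm y.
  apply: supnorm_le => z; rewrite JE; apply: le_trans (nsum _ _ _) _.
  rewrite -[leRHS]mulr1 -(phi1 z) mulr_sumr; apply: ler_sum => x _.
  rewrite normcM normc_real (ger0_norm (phi0 x z)) ler_wpM2r //.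
  by have [_ -> _] := psiP x.
(* On I(S) each psi_x is evaluation at x, so e - J (I e) at z is the sum of (e(z) - e(x)) phi_x(z),
   which the partition of unity makes small. *)
have JI e : e \in s -> supnorm (e - J (I e)) <= eps.
  move=> es; have Se : S e by exact: sf.1.
  apply: supnorm_le => z; rewrite Csphere_evalB JE.
  have -> : e z = \sum_(x <- r) e z * (phi x z)%:C.
    by rewrite -mulr_sumr -rmorph_sum /= phi1 rmorph1 mulr1.
  rewrite -sumrB; apply: le_trans (nsum _ _ _) _.
  rewrite -[leRHS]mulr1 -(phi1 z) mulr_sumr; apply: ler_sum => x _.
  have [_ _ ->] := psiP x; last exact: Se.
  rewrite -mulrBl normcM normc_real (ger0_norm (phi0 x z)) mulrC [leRHS]mulrC.
  exact: phis.
(* At y = I f the coefficients chi_e(y) expand f in the frame, so the second sum equals I (pi (f - J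
   (I f))) and P (I f) = I f holds exactly. *)
pose P (y : Y) : Y :=
  I (pi (J y)) + \sum_(e <- s) chi e y *: I (pi (e - J (I e))).
have piD a f g : pi (a *: f + g) = a *: pi f + pi g by exact: fproj_linear.
have pi_sub f g : pi (f - g) = pi f - pi g.
  by rewrite addrC -scaleN1r piD scaleN1r addrC.
have Pl : linear P.
  move=> a y z; rewrite /P JD piD Il // scalerDr addrACA; congr (_ + _).
  rewrite scaler_sumr -big_split; apply: eq_bigr => e _ /=.
  by have [-> _ _] := chiP e; rewrite scalerDl scalerA.
have Pb y : rnorm (P y) <= (c + eta) * rnorm y.
  apply: le_trans (rnormD _ _) _; rewrite mulrDl; apply: lerD.
    rewrite rI //; apply: le_trans (piB _) _; exact: ler_wpM2l.
  apply: le_trans (rnorm_sum _ _) _.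
  apply: (@le_trans _ _ (\sum_(e <- s) supnorm e * c * (rnorm y * eps))).
    rewrite big_seq [leRHS]big_seq; apply: ler_sum => e es.
    rewrite rnormZ rI // [leRHS](_ : _ = supnorm e * rnorm y * (c * eps));
      last by ring.
    apply: ler_pM; rewrite ?normc_ge0 ?s0 //.
    - by have [_ -> _] := chiP e.
    - by apply: le_trans (piB _) _; rewrite ler_wpM2l // JI.
  rewrite -mulr_suml -/B mulrCA [leRHS]mulrC; apply: ler_wpM2l;
    first exact: rnorm_ge0.
  rewrite /eps mulrA ler_pdivrMr ?ltr_wpDl // mulrC ler_pM2l //; lra.
have Pproj : bounded_projection (I @` S) P.
  split=> //.
  - by apply: le_lt_trans (op_norm_le Pb _) (ltry _); rewrite addr_ge0 // ltW.
  - move=> y; have [] := Isum _ s (fun e => chi e y) (fun e =>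
      pi (e - J (I e))).
      by move=> e _; exact: Sfp.
    move=> Sg Ig; exists (1 *: pi (J y) + \sum_(e <- s) chi e y *: pi (e - J (I
      e))).
      exact: Sl.2.
    by rewrite Il // Ig scale1r.
  - move=> _ [f Sf <-]; rewrite /P.
    have [] := Isum _ s (fun e => chi e (I f)) (fun e => pi (e - J (I e))).
      by move=> e _; exact: Sfp.
    move=> Sg <-; set g := \sum_(e <- s) _ in Sg *.
    have fE : f = \sum_(e <- s) chi e (I f) *: e.
      rewrite {1}(sf.2 f Sf); apply: eq_bigr => e _.
      by have [_ _ ->] := chiP e.
    have gE : g = pi f - pi (J (I f)).
      have [_ IE] := Isum _ s (fun e => chi e (I f)) id sf.1.
      rewrite -fE in IE.
      have -> : pi f = \sum_(e <- s) chi e (I f) *: pi e.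
        by rewrite {1}fE (linear_lin_comb _ _ _ piD).
      have -> : pi (J (I f)) = \sum_(e <- s) chi e (I f) *: pi (J (I e)).
        by rewrite {1}IE (linear_lin_comb _ _ _ JD) (linear_lin_comb _ _ _ piD).
      rewrite -sumrB; apply: eq_bigr => e _.
      by rewrite pi_sub scalerBr.
    have -> : I (pi (J (I f))) + I g = I (1 *: pi (J (I f)) + g) by rewrite Il
      // scale1r.
    by rewrite gE scale1r addrC subrK /pi -(sf.2 f Sf).
apply: le_trans (op_norm_le Pb _); last by rewrite addr_ge0 // ltW.
by apply: ereal_inf_lbound; exists P.
Qed.

End ExtensionBound.

(** * Equality of projection constant, projection norm and kernel integral *)

Theorem theorem3p12 (R : realType) (n : nat) (hn : (2 <= n)%N)
    (sigma : probability (borel_csphere R n.-1) R)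
    (hsigma : rotation_invariant sigma)
    (S : set (Csphere R n.-1))
    (finS : finite_dim_subspace S)
    (invS : unitary_invariant S)
    (accS : accessible sigma S) :
  forall xi : csphere R n.-1,
    proj_const S = op_norm (orthoprojC sigma S) /\
    op_norm (orthoprojC sigma S) =
      (\int[sigma]_z (normc (repr_kernel sigma S (xi, z)))%:E)%E.
Proof.
move=> xi; have Sl := finite_dim_lin_closed finS.
have [s sf] := finite_dim_frame hsigma finS.
pose c := \int[sigma]_y normc (frame_kernel s xi y).
have kc x : \int[sigma]_y normc (frame_kernel s x y) = c.
  exact: (frame_kernel_norm_const hsigma x xi Sl sf invS).
have c0 : 0 <= c by apply: Rintegral_ge0 => y _; exact: normc_ge0.
have piB (f : Csphere R n.-1) :
  supnorm (fproj sigma s f) <= c * supnorm f by exact: fproj_bound.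
have trB := trace_bound hsigma Sl sf accS kc.
have opE : op_norm (orthoprojC sigma S) = c%:E.
  (* The lower bound is the trace bound applied to the orthogonal projection, a bounded projection
     by accessibility. *)
  apply/eqP; rewrite eq_le; apply/andP; split; last by apply: trB;
    case: accS => _ [[]].
  apply: op_norm_le => // f; rewrite (orthoprojCE hsigma Sl sf); exact: piB.
split; rewrite opE.
  apply/eqP; rewrite eq_le; apply/andP; split.
    apply: ge_ereal_sup => _ [Y [I [II ->]]].
    exact: (rel_proj_const_le Sl sf c0 piB II).
  (* For the lower bound, the superspace is the space of continuous functions with the identity
     embedding. *)
  apply: (@le_trans _ _ (rel_proj_const S)).
    by apply: le_ereal_inf_tmp => _ [P PP <-]; exact: trB.
  apply: ereal_sup_ubound; exists (Csphere_banach R n.-1), id; split.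
    by split.
  by rewrite image_id.
under eq_integral do rewrite (repr_kernelE hsigma _ _ Sl sf).
have ki := continuous_integrable sigma (@normc_C_cts R n.-1 (frame_kernel s
  xi)).
rewrite /c /Rintegral fineK //.
exact: (integrable_fin_num measurableT ki).
Qed.
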